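(* Let $(b,c)$ be a graph over $(X,m)$ with $m=n$ and $c\equiv0$, where $n(x)=\sum_{y\in X}b(x,y)$, and let $\alpha$ be its Cheeger constant. Then $\inf\sigma(L_1)=\inf\sigma(L_2)$ if and only if $\alpha=0$.
   Context: Graphs. $X$ is a countable set with the discrete topology, $m:X\to(0,\infty)$, $m(A)=\sum_{x\in A}m(x)$ and $n(A)=\sum_{x\in A}n(x)$ for $A\subseteq X$. A graph over $(X,m)$ is a pair $(b,c)$ with $c:X\to[0,\infty)$ and $b:X\times X\to[0,\infty)$ symmetric, with zero diagonal, and $\sum_{y\in X}b(x,y)<\infty$ for all $x\in X$. It is assumed that for every $x\in X$ there is $y\in X$ with $b(x,y)>0$. Cheeger constant. $\alpha\ge0$ is the maximal $\beta\ge0$ such that $\beta\, n(W)\le|\partial W|$ for all finite $W\subseteq X$, where $|\partial W|:=\sum_{(x,y)\in W\times(X\setminus W)}b(x,y)$. Operators. $\ell^p=\ell^p(X,m)$ are the complex $\ell^p$-spaces with norms $\|f\|_p=(\sum_x|f(x)|^pm(x))^{1/p}$, $p<\infty$. $C_c(X)$ is the space of finitely supported complex functions. Let $$Q(f,g)=\frac12\sum_{x,y\in X}b(x,y)(f(x)-f(y))\overline{(g(x)-g(y))}+\sum_{x\in X}c(x)f(x)\overline{g(x)},$$ with domain $D(Q)$ the closure of $C_c(X)$ with respect to $\|f\|_Q=(Q(f,f)+\|f\|_2^2)^{1/2}$, and let $L=L_2$ be the associated positive selfadjoint operator on $\ell^2(X,m)$. The semigroup $T_t=e^{-tL}$ extends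 consistently to strongly continuous contraction semigroups on $\ell^p$, $p\in[1,\infty)$, and $L_p$ denotes the generator on $\ell^p$ with the sign convention $T_t=e^{-tL_p}$. For $m=n$, $c\equiv0$ the $L_p$ are bounded operators acting as $L_pf(x)=\frac1{n(x)}\sum_{y\in X}b(x,y)(f(x)-f(y))$. $\sigma(L_p)$ is the spectrum of $L_p$ on $\ell^p$, and $\inf\sigma(L_p)$ means $\inf\{\operatorname{Re}\lambda:\lambda\in\sigma(L_p)\}$ (the spectrum of $L_1$ need not be real). *)

(* Defs.v *)
From HB Require Import structures.
From mathcomp Require Import all_boot all_order all_algebra.
From mathcomp Require Import all_classical all_reals all_analysis.
From mathcomp Require Import complex.

Set Implicit Arguments.
Unset Strict Implicit.
Unset Printing Implicit Defensive.

Import Order.TTheory GRing.Theory Num.Theory.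
Import numFieldNormedType.Exports.
Import ComplexField.Normc.
Local Open Scope classical_set_scope.
Local Open Scope complex_scope.
Local Open Scope ring_scope.

(* Unordered sums over a countable index type.  They are only used for
   absolutely convergent families; the value is junk otherwise. *)
Definition rsum (R : realType) (I : choiceType) (u : I -> R) : R :=
  fine (\esum_(i in [set: I]) (Num.max (u i) 0)%:E)
  - fine (\esum_(i in [set: I]) (Num.max (- u i) 0)%:E).

Definition csum (R : realType) (I : choiceType) (u : I -> R[i]) : R[i] :=
  rsum (fun i => complex.Re (u i)) +i* rsum (fun i => complex.Im (u i)).

Section Graph.
Variables (R : realType) (X : countType).
Implicit Types (b : X -> X -> R) (c : X -> R).

Record is_graph b c : Prop := IsGraph {
  graph_b_ge0 : forall x y, 0 <= b x y ;
  graph_b_sym : forall x y, b x y = b y x ;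
  graph_b_diag : forall x, b x x = 0 ;
  graph_b_sum : forall x, (\esum_(y in [set: X]) (b x y)%:E < +oo)%E ;
  graph_c_ge0 : forall x, 0 <= c x ;
  graph_no_isolated : forall x, exists y, 0 < b x y }.

(* n(x) and n(A); the sum defining n(x) is finite for a graph. *)
Definition deg b (x : X) : R := fine (\esum_(y in [set: X]) (b x y)%:E).

Definition deg_set b (A : set X) : \bar R := \esum_(x in A) (deg b x)%:E.

Definition boundary_size b (W : set X) : \bar R :=
  \esum_(e in W `*` ~` W) (b e.1 e.2)%:E.

Definition cheeger_set b : set R :=
  [set beta | 0 <= beta /\
     forall W : set X, finite_set W ->
       (beta%:E * deg_set b W <= boundary_size b W)%E].

(* There is no maximal beta when X is empty, so this forces X nonempty. *)
Definition is_cheeger_constant b (alpha : R) : Prop :=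
  cheeger_set b alpha /\ ubound (cheeger_set b) alpha.

End Graph.

Section Lp.
Variables (R : realType) (X : countType) (m : X -> R) (p : R).
Implicit Types (f g : X -> R[i]).

Definition lpnorm f : \bar R :=
  ((\esum_(x in [set: X]) (normc (f x) `^ p * m x)%:E) `^ p^-1)%E.

Definition in_lp f : Prop := (lpnorm f < +oo)%E.

(* A possibly unbounded operator A on l^p is given by its graph:
   A f g means that f is in D(A) and A f = g. *)
Definition operator := (X -> R[i]) -> (X -> R[i]) -> Prop.

(* The maps T t are total on functions X -> C, but only their values on l^p
   and for t >= 0 are constrained or used. *)
Record c0_contraction_semigroup (T : R -> (X -> R[i]) -> (X -> R[i])) : Prop :=
  C0ContractionSemigroup {
  sg_lp : forall (t : R) f, 0 <= t -> in_lp f -> in_lp (T t f) ;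
  sg_linear : forall (t : R) (a : R[i]) f g, 0 <= t -> in_lp f -> in_lp g ->
    T t (fun x => a * f x + g x) = (fun x => a * T t f x + T t g x) ;
  sg_0 : forall f, in_lp f -> T 0 f = f ;
  sg_add : forall (s t : R) f, 0 <= s -> 0 <= t -> in_lp f ->
    T (s + t) f = T s (T t f) ;
  sg_contraction : forall (t : R) f, 0 <= t -> in_lp f ->
    (lpnorm (T t f) <= lpnorm f)%E ;
  sg_continuous : forall f, in_lp f ->
    lpnorm (T t f \- f) @[t --> 0^'+] --> (0 : \bar R) }.

(* Sign convention T_t = e^{-tA}. *)
Definition generator (T : R -> (X -> R[i]) -> (X -> R[i])) : operator :=
  fun f g => [/\ in_lp f, in_lp g &
    lpnorm (fun x => t^-1%:C * (f x - T t f x) - g x)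
      @[t --> 0^'+] --> (0 : \bar R)].

(* A - lambda : D(A) -> l^p is bijective with bounded inverse. *)
Definition resolvent_set (A : operator) : set R[i] :=
  [set lambda |
    (forall g, in_lp g ->
       exists! f, A f (fun x => lambda * f x + g x)) /\
    exists K : R, forall f h, A f h ->
      (lpnorm f <= K%:E * lpnorm (fun x => (h x - lambda * f x)%R))%E].

Definition spectrum (A : operator) : set R[i] := ~` resolvent_set A.

Definition inf_spectrum (A : operator) : \bar R :=
  ereal_inf [set (complex.Re lambda)%:E | lambda in spectrum A].

End Lp.

Section Laplacian.
Variables (R : realType) (X : countType).
Variables (m : X -> R) (b : X -> X -> R) (c : X -> R).
Implicit Types (f g h : X -> R[i]).

Definition inner f g : R[i] := csum (fun x => f x * (g x)^* * (m x)%:C).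

Definition finitely_supported f : Prop := finite_set [set x | f x != 0].

Definition qform f g : R[i] :=
  2^-1 * csum (fun e : X * X =>
    (b e.1 e.2)%:C * (f e.1 - f e.2) * (g e.1 - g e.2)^*)
  + csum (fun x => (c x)%:C * f x * (g x)^*).

(* Q(f, f), as an extended real: all terms are nonnegative. *)
Definition qform_diag f : \bar R :=
  ((2^-1)%:E * (\esum_(e in [set: X * X])
     (b e.1 e.2 * normc (f e.1 - f e.2) ^+ 2)%:E)
   + \esum_(x in [set: X]) (c x * normc (f x) ^+ 2)%:E)%E.

Definition qnorm f : \bar R :=
  ((qform_diag f + lpnorm m 2 f `^ 2) `^ 2^-1)%E.

Definition qform_domain f : Prop :=
  forall eps : R, 0 < eps ->
    exists phi, finitely_supported phi /\ (qnorm (f \- phi)%R < eps%:E)%E.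

(* The positive selfadjoint operator L = L_2 on l^2 associated with the closed
   form (Q, D(Q)). *)
Definition form_laplacian : operator R X :=
  fun f g => [/\ qform_domain f, in_lp m 2 g &
    forall h, qform_domain h -> qform f h = inner g h].

(* T_t = e^{-tL}: the strongly continuous semigroup on l^2 generated by -L. *)
Definition is_heat_semigroup (T : R -> (X -> R[i]) -> (X -> R[i])) : Prop :=
  c0_contraction_semigroup m 2 T /\
  forall f g, generator m 2 T f g <-> form_laplacian f g.

(* A is L_p: the generator of the strongly continuous contraction semigroup on
   l^p that agrees with the heat semigroup on the intersection of l^2 and l^p.
   It is unique since this intersection is dense in l^p. *)
Definition is_lp_laplacian (p : R) (A : operator R X) : Prop :=
  exists T Tp, [/\ is_heat_semigroup T,
    c0_contraction_semigroup m p Tp,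
    (forall (t : R) f, 0 <= t -> in_lp m 2 f -> in_lp m p f -> Tp t f = T t f) &
    forall f g, A f g <-> generator m p Tp f g].

End Laplacian.

(* Main.v *)
Require Import Defs.
From HB Require Import structures.
From mathcomp Require Import all_boot all_order all_algebra.
From mathcomp Require Import all_classical all_reals all_analysis.
From mathcomp Require Import complex ring lra.

Set Implicit Arguments.
Unset Strict Implicit.
Unset Printing Implicit Defensive.

Import Order.TTheory GRing.Theory Num.Theory.
Import numFieldNormedType.Exports.
Import ComplexField.Normc.
Local Open Scope classical_set_scope.
Local Open Scope complex_scope.
Local Open Scope ring_scope.

(** Since [m = n] and [c = 0], the Laplacian is the bounded operator
    [L f = f - P f], where [P] is the transition operator of the random walk with
    jump probabilities [b x y / m x]. By Jensen's inequality [P] is a contraction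
    of every l^p ([lpnorm_walk]), so that [|1 - lambda| > 1 >= |P|] when
    [Re lambda < 0]: both spectra lie in the right half-plane
    ([resolvent_Re_lt0]).

    On l^1 the bottom of the spectrum is always [0]. The walk preserves the total
    [m]-mass, hence [L f] has mass zero and [L] is not onto ([spectrum1_0]). The
    theorem thus says that the bottom of the l^2 spectrum is [0] if and only if
    [alpha = 0].

    If [alpha > 0], Cheeger's inequality bounds the form below by
    [alpha ^ 2 / 2] times the squared norm ([cheeger_inequality]). For
    [Re lambda < alpha ^ 2 / 2] and small [s > 0] the operator
    [1 - s (L - lambda)] is then a strict contraction, and [L - lambda] is
    inverted by a Neumann series ([resolvent_below_gap]). If [alpha = 0] and [0]
    were in the resolvent set, [L] would be bounded below; applied to indicators
    of finite sets, with [|L f| ^ 2 <= 2 Q(f, f)], this would yield a positive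
    isoperimetric constant ([cheeger_of_bounded_below]).

    It remains to identify the two generators with [L]. On l^2 the form is bounded,
    its domain is everything, and Green's formula gives [Q(f, h) = (L f, h)]
    ([form_laplacianP]). On l^1 the semigroup is only known to agree with the l^2
    semigroup on the intersection. There one has
    [f - T_t f - t L f = \int_0^t (T_s L f - L f) ds]; the integral is replaced by
    Riemann sums, whose l^1 norm is controlled by strong continuity in l^1 and
    which converge in l^2, hence pointwise, to the left-hand side. The resulting
    l^1 estimate extends to all of l^1 by density ([duhamel]), and it says that the
    generator is [L] ([generator_L1P]).

    Signed and complex sums are reduced to nonnegative ones by [rsum_diff]: any
    decomposition into summable nonnegative parts computes them. *)

Local Notation nsum u := (\esum_(i in [set: _]) (u i)%:E)%E.

Lemma le_of_eq {R : realType} (x y : R) : x = y -> x <= y.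
Proof. by move=> ->. Qed.

(** * Sums of nonnegative families *)

Section NonnegativeSums.
Context {R : realType}.
Implicit Types (I J : choiceType).

Lemma nsum_ge0 I (u : I -> R) : (forall i, 0 <= u i) -> (0 <= nsum u)%E.
Proof. by move=> u0; apply: esum_ge0 => i _; rewrite lee_fin. Qed.

Lemma le_nsum I (u v : I -> R) : (forall i, u i <= v i) -> (nsum u <= nsum v)%E.
Proof. by move=> uv; apply: le_esum => i _; rewrite lee_fin. Qed.

Lemma eq_nsum I (u v : I -> R) : u =1 v -> nsum u = nsum v.
Proof. by move=> uv; apply: eq_esum => i _; rewrite uv. Qed.

Lemma nsumD I (u v : I -> R) : (forall i, 0 <= u i) -> (forall i, 0 <= v i) ->
  (nsum (fun i => (u i + v i)%R) = nsum u + nsum v)%E.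
Proof.
move=> u0 v0; rewrite -esumD => [||i _]; first by apply: eq_esum.
  by move=> i _; rewrite lee_fin.
by rewrite lee_fin.
Qed.

Lemma nsum_le I (u : I -> R) (M : \bar R) : 
  (forall s : seq I, uniq s -> ((\sum_(i <- s) u i)%:E <= M)%E) -> (nsum u <= M)%E.
Proof.
move=> uM; apply: ge_ereal_sup => _ [A [finA _] <-].
by rewrite fsbig_finite//= sumEFin; apply: uM.
Qed.

Lemma nsum_ge I (u : I -> R) (s : seq I) : uniq s ->
  ((\sum_(i <- s) u i)%:E <= nsum u)%E.
Proof.
move=> us; apply: esum_ge; exists [set` s] => //.
by rewrite -sumEFin fsbig_seq.
Qed.

Lemma nsum_ge1 I (u : I -> R) (i : I) : ((u i)%:E <= nsum u)%E.
Proof. by have := @nsum_ge _ u [:: i] isT; rewrite big_seq1. Qed.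

Lemma nsumZ I (u : I -> R) (k : R) : 0 <= k -> (forall i, 0 <= u i) ->
  (nsum (fun i => (k * u i)%R) = k%:E * nsum u)%E.
Proof.
move=> k0 u0; apply/eqP; rewrite eq_le; apply/andP; split.
  apply: nsum_le => s us; rewrite -mulr_sumr EFinM lee_wpmul2l ?lee_fin//.
  exact: nsum_ge.
have [->|kn0] := eqVneq k 0.
  by rewrite mul0e; apply: nsum_ge0 => i; rewrite mul0r.
have kgt0 : 0 < k by rewrite lt_neqAle eq_sym kn0.
rewrite -lee_pdivlMl//; apply: nsum_le => s us.
rewrite lee_pdivlMl// -EFinM mulr_sumr; exact: nsum_ge.
Qed.

Lemma fine_nsumK I (u : I -> R) : (forall i, 0 <= u i) -> (nsum u < +oo)%E ->
  (fine (nsum u))%:E = nsum u.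
Proof. by move=> u0 uoo; rewrite fineK// ge0_fin_numE// nsum_ge0. Qed.

Lemma nsum_lty_le I (u v : I -> R) : (forall i, u i <= v i) ->
  (nsum v < +oo)%E -> (nsum u < +oo)%E.
Proof. by move=> uv; apply: le_lt_trans; exact: le_nsum. Qed.

Lemma nsum_lty_D I (u v : I -> R) : (forall i, 0 <= u i) ->
  (forall i, 0 <= v i) -> (nsum u < +oo)%E -> (nsum v < +oo)%E ->
  (nsum (fun i => (u i + v i)%R) < +oo)%E.
Proof. by move=> u0 v0 uoo voo; rewrite nsumD// lte_add_pinfty. Qed.

Lemma nsum_lty_Z I (u : I -> R) (k : R) : 0 <= k -> (forall i, 0 <= u i) ->
  (nsum u < +oo)%E -> (nsum (fun i => (k * u i)%R) < +oo)%E.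
Proof.
by move=> k0 u0 uoo; rewrite nsumZ// -fine_nsumK// -EFinM ltry.
Qed.

Lemma nsum_pair I J (u : I * J -> R) : (forall e, 0 <= u e) ->
  nsum u = (\esum_(i in [set: I]) nsum (fun j => u (i, j)))%E.
Proof.
move=> u0; rewrite (@esum_esum _ _ _ setT (fun=> setT) (fun i j => (u (i, j))%:E)).
  rewrite (_ : _ `*`` _ = setT) //; last by apply/seteqP; split.
  by apply: eq_esum => -[].
by move=> i j _ _; rewrite lee_fin.
Qed.

Lemma nsum_swap I J (u : I * J -> R) : nsum u = nsum (fun e : J * I => u (e.2, e.1)).
Proof.
rewrite (@reindex_esum _ _ _ setT setT (fun e : J * I => (e.2, e.1)))//.
split=> //; first by move=> [i j] [i' j'] _ _ [-> ->].
by move=> [i j] _; exists (j, i).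
Qed.

Lemma nsum_row_lty I J (u : I * J -> R) : (forall e, 0 <= u e) ->
  (nsum u < +oo)%E -> forall i, (nsum (fun j => u (i, j)) < +oo)%E.
Proof.
move=> u0; rewrite nsum_pair// => uoo i; apply: le_lt_trans uoo.
apply: esum_ge; exists [set i]; first by split.
by rewrite fsbig_set1.
Qed.

Lemma nsum_pair_fine I J (u : I * J -> R) : (forall e, 0 <= u e) ->
  (forall i, (nsum (fun j => u (i, j)) < +oo)%E) ->
  nsum u = nsum (fun i => fine (nsum (fun j => u (i, j)))).
Proof.
by move=> u0 uoo; rewrite nsum_pair//; apply: eq_esum => i _; rewrite fine_nsumK.
Qed.

End NonnegativeSums.

(** * Sums of signed and complex families *)

Section SignedSums.
Context {R : realType}.
Implicit Types (I J : choiceType).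

Definition rsummable I (u : I -> R) := (nsum (fun i => `|u i|) < +oo)%E.

(** The value of [rsum] does not depend on the way a family is written as a
    difference of nonnegative summable families; this reduces every identity
    between signed sums to one between nonnegative sums. *)
Lemma rsum_diff I (u p q : I -> R) :
  (forall i, 0 <= p i) -> (forall i, 0 <= q i) ->
  (nsum p < +oo)%E -> (nsum q < +oo)%E -> (forall i, u i = p i - q i) ->
  rsum u = fine (nsum p) - fine (nsum q).
Proof.
move=> p0 q0 poo qoo uE; rewrite /rsum.
pose v i := Num.max (u i) 0; pose w i := Num.max (- u i) 0.
have v0 i : 0 <= v i by rewrite le_max lexx orbT.
have w0 i : 0 <= w i by rewrite le_max lexx orbT.
have voo : (nsum v < +oo)%E.
  apply: nsum_lty_le poo => i; rewrite ge_max p0 andbT uE.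
  by rewrite lerBlDr lerDl.
have woo : (nsum w < +oo)%E.
  apply: nsum_lty_le qoo => i; rewrite ge_max q0 andbT uE opprB.
  by rewrite lerBlDr lerDl.
have E : (nsum v + nsum q = nsum w + nsum p)%E.
  rewrite -!nsumD//; apply: eq_nsum => i; rewrite /v /w.
  move: (uE i) => /eqP; rewrite eq_sym subr_eq => /eqP ->.
  by case: (leP (u i) 0) => h; case: (leP (- u i) 0) => h'; lra.
rewrite -(fine_nsumK v0)// -(fine_nsumK w0)// -(fine_nsumK p0)// in E.
rewrite -(fine_nsumK q0)// in E; case: E; rewrite -/(nsum v) -/(nsum w).
move: (fine _) (fine _) (fine _) (fine _) => a b' c' d; lra.
Qed.

Lemma rsum_pos I (u : I -> R) : (forall i, 0 <= u i) -> rsum u = fine (nsum u).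
Proof.
move=> u0; rewrite /rsum [X in _ - fine X]esum1 ?subr0; last first.
  by move=> i _; rewrite max_r// oppr_le0.
by congr fine; apply: eq_nsum => i; rewrite max_l.
Qed.

Lemma eq_rsum I (u v : I -> R) : u =1 v -> rsum u = rsum v.
Proof. by move=> /funext ->. Qed.

Definition ppart I (u : I -> R) i := Num.max (u i) 0.
Definition npart I (u : I -> R) i := Num.max (- u i) 0.

Lemma ppart_ge0 I (u : I -> R) i : 0 <= ppart u i.
Proof. by rewrite le_max lexx orbT. Qed.
Lemma npart_ge0 I (u : I -> R) i : 0 <= npart u i.
Proof. by rewrite le_max lexx orbT. Qed.
Local Hint Resolve ppart_ge0 npart_ge0 : core.

Lemma partB I (u : I -> R) i : u i = ppart u i - npart u i.
Proof.
by rewrite /ppart /npart; case: (leP (u i) 0); case: (leP (- u i) 0); lra.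
Qed.
Lemma ppart_le I (u : I -> R) i : ppart u i <= `|u i|.
Proof. by rewrite ge_max ler_norm normr_ge0. Qed.
Lemma npart_le I (u : I -> R) i : npart u i <= `|u i|.
Proof. by rewrite ge_max -normrN ler_norm normr_ge0. Qed.

Lemma ppart_lty I (u : I -> R) : rsummable u -> (nsum (ppart u) < +oo)%E.
Proof. exact/nsum_lty_le/ppart_le. Qed.
Lemma npart_lty I (u : I -> R) : rsummable u -> (nsum (npart u) < +oo)%E.
Proof. exact/nsum_lty_le/npart_le. Qed.

Lemma part_fin I (u : I -> R) : rsummable u ->
  (nsum (ppart u) \is a fin_num) * (nsum (npart u) \is a fin_num).
Proof.
by move=> uoo; rewrite !ge0_fin_numE ?nsum_ge0//; split;
  [exact: ppart_lty|exact: npart_lty].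
Qed.

Lemma rsumE I (u : I -> R) : rsum u = fine (nsum (ppart u)) - fine (nsum (npart u)).
Proof. by []. Qed.

Lemma rsummableD I (u v : I -> R) : rsummable u -> rsummable v ->
  rsummable (fun i => u i + v i).
Proof.
move=> uoo voo; apply: nsum_lty_le (nsum_lty_D _ _ uoo voo) => // i.
exact: ler_normD.
Qed.

Lemma rsummableZ I (u : I -> R) (k : R) : rsummable u ->
  rsummable (fun i => k * u i).
Proof.
move=> uoo; apply: nsum_lty_le (nsum_lty_Z (normr_ge0 k) _ uoo) => // i.
by rewrite normrM.
Qed.

Lemma rsumD I (u v : I -> R) : rsummable u -> rsummable v ->
  rsum (fun i => u i + v i) = rsum u + rsum v.
Proof.
move=> uoo voo.
pose p i := ppart u i + ppart v i; pose q i := npart u i + npart v i.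
rewrite (@rsum_diff _ _ p q) ?rsumE.
- rewrite (nsumD (ppart_ge0 u) (ppart_ge0 v)).
  rewrite (nsumD (npart_ge0 u) (npart_ge0 v)).
  rewrite !fineD ?(part_fin uoo) ?(part_fin voo)//.
  by rewrite opprD addrACA.
- by move=> i; rewrite addr_ge0 ?ppart_ge0.
- by move=> i; rewrite addr_ge0 ?npart_ge0.
- by apply: nsum_lty_D => //; exact: ppart_lty.
- by apply: nsum_lty_D => //; exact: npart_lty.
- by move=> i; rewrite (partB u) (partB v) /p /q opprD addrACA.
Qed.

Lemma rsumN I (u : I -> R) : rsum (fun i => - u i) = - rsum u.
Proof.
rewrite /rsum opprB; congr (_ - fine _).
by apply: eq_nsum => i; rewrite opprK.
Qed.

Lemma rsummableN I (u : I -> R) : rsummable u -> rsummable (fun i => - u i).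
Proof. by rewrite /rsummable; under [in X in _ -> X]eq_esum do rewrite normrN. Qed.

Lemma rsumZ I (u : I -> R) (k : R) : rsummable u ->
  rsum (fun i => k * u i) = k * rsum u.
Proof.
wlog k0 : k / 0 <= k => [H uoo|uoo].
  have [k0|k0] := leP 0 k; first exact: H.
  rewrite -[k]opprK mulNr -H ?oppr_ge0 ?(ltW k0)// -rsumN.
  by apply: eq_rsum => i; rewrite mulNr.
rewrite (@rsum_diff _ _ (fun i => k * ppart u i) (fun i => k * npart u i)).
- rewrite rsumE !nsumZ//.
  by rewrite !fineM ?(part_fin uoo)// mulrBr.
- by move=> i; rewrite mulr_ge0 ?ppart_ge0.
- by move=> i; rewrite mulr_ge0 ?npart_ge0.
- by apply: nsum_lty_Z => //; exact: ppart_lty.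
- by apply: nsum_lty_Z => //; exact: npart_lty.
- by move=> i; rewrite -mulrBr -partB.
Qed.

Lemma ler_rsum I (u v : I -> R) : rsummable u -> rsummable v ->
  (forall i, u i <= v i) -> rsum u <= rsum v.
Proof.
move=> uoo voo uv; rewrite -subr_ge0 -rsumN -rsumD//; last exact: rsummableN.
rewrite rsum_pos; last by move=> i; rewrite subr_ge0.
by rewrite fine_ge0// nsum_ge0// => i; rewrite subr_ge0.
Qed.

Lemma rsummable_norm I (u : I -> R) : rsummable u -> rsummable (fun i => `|u i|).
Proof. by rewrite /rsummable; under [in X in _ -> X]eq_esum do rewrite normr_id. Qed.

Lemma ler_norm_rsum I (u : I -> R) : rsummable u ->
  `|rsum u| <= rsum (fun i => `|u i|).
Proof.
move=> uoo; have noo := rsummable_norm uoo; rewrite ler_norml lerNl -rsumN.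
apply/andP; split; apply: ler_rsum => //.
- exact: rsummableN.
- by move=> i; rewrite -normrN ler_norm.
- by move=> i; exact: ler_norm.
Qed.

Lemma rsum_pair_summable I J (u : I * J -> R) : rsummable u ->
  (forall i, rsummable (fun j => u (i, j))) /\
  rsummable (fun i => rsum (fun j => u (i, j))).
Proof.
move=> uoo; have row := nsum_row_lty (fun e => normr_ge0 (u e)) uoo.
split=> //; rewrite /rsummable.
move: uoo; rewrite /rsummable (nsum_pair_fine _ row)//.
apply: nsum_lty_le => i; rewrite -rsum_pos//; exact: ler_norm_rsum (row i).
Qed.

(** Fubini's theorem: the positive and negative parts satisfy Tonelli's theorem
    separately, and their row sums decompose the row sums of [u]. *)
Lemma rsum_pair I J (u : I * J -> R) : rsummable u ->
  rsum u = rsum (fun i => rsum (fun j => u (i, j))).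
Proof.
move=> uoo; have [row _] := rsum_pair_summable uoo.
pose p i := fine (nsum (fun j => ppart u (i, j))).
pose q i := fine (nsum (fun j => npart u (i, j))).
have pE : nsum (ppart u) = nsum p.
  apply: nsum_pair_fine => [e|i]; first exact: ppart_ge0.
  exact: (ppart_lty (row i)).
have qE : nsum (npart u) = nsum q.
  apply: nsum_pair_fine => [e|i]; first exact: npart_ge0.
  exact: (npart_lty (row i)).
rewrite (@rsum_diff _ _ p q) ?rsumE ?pE ?qE//.
- by move=> i; apply/fine_ge0/nsum_ge0 => j; exact: ppart_ge0.
- by move=> i; apply/fine_ge0/nsum_ge0 => j; exact: npart_ge0.
- by rewrite -pE; exact: ppart_lty.
- by rewrite -qE; exact: npart_lty.
Qed.

Lemma rsum_swap I J (u : I * J -> R) : rsum u = rsum (fun e : J * I => u (e.2, e.1)).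
Proof.
by rewrite !rsumE (nsum_swap (ppart u)) (nsum_swap (npart u)).
Qed.

End SignedSums.

Section ComplexModulus.
Context {R : realType}.
Implicit Types (z w : R[i]) (k : R).

Lemma normc_ge0 z : 0 <= normc z.
Proof. by case: z => a b'; exact: sqrtr_ge0. Qed.

Lemma normcD_le z w : normc (z + w) <= normc z + normc w.
Proof. exact: le_normcD. Qed.

Lemma normc_opp z : normc (- z) = normc z.
Proof. exact: normcN. Qed.

Lemma normc_dist z w : normc (z - w) = normc (w - z).
Proof. by rewrite -normc_opp opprB. Qed.

Lemma normc_zero : normc (0 : R[i]) = 0.
Proof. exact: normc0. Qed.

Lemma normc_sqr z : normc z ^+ 2 = complex.Re z ^+ 2 + complex.Im z ^+ 2.
Proof. by case: z => a b' /=; rewrite sqr_sqrtr// addr_ge0 ?sqr_ge0. Qed.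

Lemma normc_conjc z : normc (conjc z) = normc z.
Proof. by case: z => a b' /=; rewrite sqrrN. Qed.

Lemma normc_real k : normc k%:C = `|k|.
Proof. by rewrite /normc /= expr0n addr0 sqrtr_sqr. Qed.

Lemma ler_Re_normc z : `|complex.Re z| <= normc z.
Proof.
by rewrite -sqrtr_sqr; case: z => a b' /=; rewrite ler_sqrt ?lerDl ?addr_ge0 ?sqr_ge0.
Qed.

Lemma ler_Im_normc z : `|complex.Im z| <= normc z.
Proof.
by rewrite -sqrtr_sqr; case: z => a b' /=; rewrite ler_sqrt ?lerDr ?addr_ge0 ?sqr_ge0.
Qed.

Lemma ler_normc_ReIm z : normc z <= `|complex.Re z| + `|complex.Im z|.
Proof.
rewrite -(@ler_pXn2r _ 2) ?nnegrE ?addr_ge0 ?normc_ge0//.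
rewrite normc_sqr sqrrD !real_normK ?num_real//.
by rewrite addrAC lerDl mulrn_wge0// mulr_ge0.
Qed.

Lemma conjE z : Num.conj z = conjc z.
Proof. by []. Qed.

Lemma mul_conjc z : z * conjc z = (normc z ^+ 2)%:C.
Proof.
rewrite normc_sqr; case: z => a b' /=; apply/eqP; rewrite eq_complex /=.
by apply/andP; split; apply/eqP; ring.
Qed.

Lemma mulc_conj z : conjc z * z = (normc z ^+ 2)%:C.
Proof. by rewrite mulrC mul_conjc. Qed.

Lemma Re_realM k z : complex.Re (k%:C * z) = k * complex.Re z.
Proof. by case: z => a b' /=; rewrite mul0r subr0. Qed.

Lemma mulVKc k z : k != 0 -> k%:C * (k^-1%:C * z) = z.
Proof. by move=> k0; rewrite mulrA -rmorphM mulfV// rmorph1 mul1r. Qed.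

Lemma mulKVc k z : k != 0 -> k^-1%:C * (k%:C * z) = z.
Proof. by move=> k0; rewrite mulrA -rmorphM mulVf// rmorph1 mul1r. Qed.

Lemma Re_addc z w : complex.Re (z + w) = complex.Re z + complex.Re w.
Proof. by case: z w => ? ? []. Qed.

Lemma Im_addc z w : complex.Im (z + w) = complex.Im z + complex.Im w.
Proof. by case: z w => ? ? []. Qed.

Lemma Re_oppc z : complex.Re (- z) = - complex.Re z.
Proof. by case: z. Qed.

Lemma Im_oppc z : complex.Im (- z) = - complex.Im z.
Proof. by case: z. Qed.

Lemma Re_mulc z w : complex.Re (z * w) =
  complex.Re z * complex.Re w - complex.Im z * complex.Im w.
Proof. by case: z w => ? ? []. Qed.

Lemma Im_mulc z w : complex.Im (z * w) =
  complex.Re z * complex.Im w + complex.Im z * complex.Re w.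
Proof. by case: z w => ? ? []. Qed.

Lemma complex_ext z w : complex.Re z = complex.Re w ->
  complex.Im z = complex.Im w -> z = w.
Proof. by case: z w => ? ? [? ?] /= -> ->. Qed.

End ComplexModulus.

#[local] Hint Extern 0 (is_true (0 <= normc _)) => exact: normc_ge0 : core.

Section ComplexSums.
Context {R : realType}.
Implicit Types (I J : choiceType).

Definition csummable I (u : I -> R[i]) := (nsum (fun i => normc (u i)) < +oo)%E.

Lemma csummable_Re I (u : I -> R[i]) : csummable u ->
  rsummable (fun i => complex.Re (u i)).
Proof. by apply: nsum_lty_le => i; exact: ler_Re_normc. Qed.

Lemma csummable_Im I (u : I -> R[i]) : csummable u ->
  rsummable (fun i => complex.Im (u i)).
Proof. by apply: nsum_lty_le => i; exact: ler_Im_normc. Qed.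

Lemma csummableD I (u v : I -> R[i]) : csummable u -> csummable v ->
  csummable (fun i => u i + v i).
Proof.
move=> uoo voo; apply: nsum_lty_le (nsum_lty_D _ _ uoo voo) => // i.
exact: normcD_le.
Qed.

Lemma csummableZ I (u : I -> R[i]) (k : R[i]) : csummable u ->
  csummable (fun i => k * u i).
Proof.
move=> uoo; apply: nsum_lty_le (nsum_lty_Z (normc_ge0 k) _ uoo) => // i.
by rewrite normcM.
Qed.

Lemma csummableN I (u : I -> R[i]) : csummable u -> csummable (fun i => - u i).
Proof.
by move=> uoo; apply: nsum_lty_le uoo => i; rewrite normc_opp.
Qed.

Lemma eq_csum I (u v : I -> R[i]) : u =1 v -> csum u = csum v.
Proof. by move=> /funext ->. Qed.

Lemma csumD I (u v : I -> R[i]) : csummable u -> csummable v ->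
  csum (fun i => u i + v i) = csum u + csum v.
Proof.
move=> uoo voo; apply: complex_ext; rewrite ?Re_addc ?Im_addc /=.
  rewrite -rsumD; [|exact: csummable_Re..].
  by apply: eq_rsum => i; rewrite Re_addc.
rewrite -rsumD; [|exact: csummable_Im..].
by apply: eq_rsum => i; rewrite Im_addc.
Qed.

Lemma csumZ I (u : I -> R[i]) (k : R[i]) : csummable u ->
  csum (fun i => k * u i) = k * csum u.
Proof.
move=> uoo; have uR := csummable_Re uoo; have uI := csummable_Im uoo.
apply: complex_ext; rewrite ?Re_mulc ?Im_mulc /=.
  rewrite -!rsumZ// -rsumN -rsumD; first by apply: eq_rsum => i; rewrite Re_mulc.
    exact: rsummableZ.
  exact/rsummableN/rsummableZ.
rewrite -!rsumZ// -rsumD; first by apply: eq_rsum => i; rewrite Im_mulc.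
  exact: rsummableZ.
exact: rsummableZ.
Qed.

Lemma csumN I (u : I -> R[i]) : csum (fun i => - u i) = - csum u.
Proof.
apply: complex_ext; rewrite ?Re_oppc ?Im_oppc /= -rsumN; apply: eq_rsum => i.
  by rewrite Re_oppc.
by rewrite Im_oppc.
Qed.

Lemma csumB I (u v : I -> R[i]) : csummable u -> csummable v ->
  csum (fun i => u i - v i) = csum u - csum v.
Proof. by move=> uoo voo; rewrite csumD ?csumN//; exact: csummableN. Qed.

Lemma csumZr I (u : I -> R[i]) (k : R[i]) : csummable u ->
  csum (fun i => u i * k) = csum u * k.
Proof.
by move=> uoo; rewrite mulrC -csumZ//; apply: eq_csum => i; rewrite mulrC.
Qed.

Lemma csum0 I : csum (fun _ : I => 0 : R[i]) = 0.
Proof.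
by apply: complex_ext; rewrite /= rsum_pos//; rewrite esum1.
Qed.

Lemma csum_real I (u : I -> R) : csum (fun i => (u i)%:C) = (rsum u)%:C.
Proof.
apply: complex_ext => //=; by rewrite rsum_pos// esum1.
Qed.

(** Triangle inequality: the sum is rotated onto the positive real axis, where
    the modulus is a real part. *)
Lemma normc_csum I (u : I -> R[i]) : csummable u ->
  normc (csum u) <= fine (nsum (fun i => normc (u i))).
Proof.
move=> uoo; set z := csum u; set S := fine _.
have S0 : 0 <= S by apply/fine_ge0/nsum_ge0.
have [z0|z0] := eqVneq (normc z) 0; first by rewrite z0.
have zgt0 : 0 < normc z by rewrite lt_neqAle eq_sym z0/=.
rewrite -(ler_pM2l zgt0) -expr2.
have -> : normc z ^+ 2 = complex.Re (csum (fun i => conjc z * u i)).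
  by rewrite csumZ// mulc_conj.
have zuoo := csummableZ (conjc z) uoo.
apply: le_trans (ler_norm _) _ => /=.
apply: le_trans (ler_norm_rsum (csummable_Re zuoo)) _.
rewrite rsum_pos// -lee_fin fine_nsumK//; last exact: csummable_Re.
rewrite EFinM fine_nsumK// -nsumZ//; apply: le_nsum => i.
by apply: le_trans (ler_Re_normc _) _; rewrite normcM normc_conjc.
Qed.

Lemma csum_pair I J (u : I * J -> R[i]) : csummable u ->
  csum u = csum (fun i => csum (fun j => u (i, j))).
Proof.
move=> uoo; apply: complex_ext => /=.
  by rewrite rsum_pair//; exact: csummable_Re.
by rewrite rsum_pair//; exact: csummable_Im.
Qed.

Lemma csum_swap I J (u : I * J -> R[i]) :
  csum u = csum (fun e : J * I => u (e.2, e.1)).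
Proof. by apply: complex_ext; rewrite /= rsum_swap. Qed.

Lemma csummable_swap I J (u : I * J -> R[i]) : csummable u ->
  csummable (fun e : J * I => u (e.2, e.1)).
Proof. by rewrite /csummable nsum_swap. Qed.

End ComplexSums.

(** * Norms on l^p *)

Section PowerFunction.
Context {R : realType}.
Implicit Types (p s t a : R).

(** Young's inequality with conjugate exponents [p] and [p / (p - 1)], read as the
    convexity of [t `^ p]: the graph lies above the tangent at [s]. Minkowski's and
    Jensen's inequalities are both sums of instances of it. *)
Lemma powR_tangent p s t : 1 <= p -> 0 <= s -> 0 <= t ->
  s `^ p + p * s `^ (p - 1) * (t - s) <= t `^ p.
Proof.
move=> p1 s0 t0; have p0 : 0 < p by exact: lt_le_trans p1.
rewrite mulrBr -[in X in _ - X]mulrA (mulrC (s `^ _)) mulr_powRB1//.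
have [->|pn1] := eqVneq p 1.
  by rewrite subrr powRr0 !powRr1// !mul1r addrCA subrr addr0.
have {pn1} p1' : 0 < p - 1 by rewrite subr_gt0 lt_neqAle eq_sym pn1.
have pqE : p^-1 + (p / (p - 1))^-1 = 1.
  by rewrite invf_div -{1}(div1r p) -mulrDl subrKC mulfV// gt_eqF.
have := conjugate_powR t0 (powR_ge0 s (p - 1)) p0 (divr_gt0 p0 p1') pqE.
rewrite -powRrM mulrCA mulfV ?mulr1 ?gt_eqF// invf_div => H.
have : p * (t * s `^ (p - 1)) <= p * (t `^ p / p + s `^ p * ((p - 1) / p)).
  by rewrite ler_pM2l.
have -> : p * (t `^ p / p + s `^ p * ((p - 1) / p)) = t `^ p + s `^ p * (p - 1).
  by field; rewrite gt_eqF.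
move: (s `^ p) (t `^ p) (s `^ (p - 1)) => a b' c' => {}H.
rewrite -subr_ge0; apply: le_trans (_ : 0 <= b' + a * (p - 1) - p * (t * c')) _.
  by rewrite subr_ge0.
by apply: le_of_eq; ring.
Qed.

Lemma powR_le_cancel p a s : 0 < p -> 0 <= a -> 0 <= s -> a `^ p <= s `^ p -> a <= s.
Proof.
move=> p0 a0 s0; apply: contraTT; rewrite -!ltNge => sa.
by apply: gt0_ltr_powR => //; rewrite nnegrE.
Qed.

Lemma powRVK p a : 0 < p -> 0 <= a -> (a `^ p^-1) `^ p = a.
Proof. by move=> p0 a0; rewrite -powRrM mulVf ?gt_eqF// powRr1. Qed.

Lemma powRKV p a : 0 < p -> 0 <= a -> (a `^ p) `^ p^-1 = a.
Proof. by move=> p0 a0; rewrite -powRrM mulfV ?gt_eqF// powRr1. Qed.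

Lemma powR_div p a s : 0 <= a -> 0 <= s -> (a / s) `^ p = a `^ p / s `^ p.
Proof.
move=> a0 s0; rewrite powRM ?invr_ge0//; congr (_ * _).
by rewrite -[LHS](congr1 (@powR R ^~ p) (powR_inv1 s0)) -powRrM mulN1r powRN.
Qed.

(** With [A] and [B] bounds for the norms of two functions, the right-hand side
    sums to at most [(A + B) `^ p]: Minkowski's inequality is the sum of this one. *)
Lemma convex_powR_scaled p (A B a b' : R) : 1 <= p -> 0 < A -> 0 < B -> 
  0 <= a -> 0 <= b' ->
  (a + b') `^ p <=
    (A + B) `^ p * (A / (A + B) * (a / A) `^ p + B / (A + B) * (b' / B) `^ p).
Proof.
move=> p1 A0 B0 a0 b0; have AB : 0 < A + B by rewrite addr_gt0.
set s := (a + b') / (A + B).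
have s0 : 0 <= s by rewrite divr_ge0 ?addr_ge0// ltW.
have aA : 0 <= a / A by rewrite divr_ge0// ltW.
have bB : 0 <= b' / B by rewrite divr_ge0// ltW.
have -> : a + b' = (A + B) * s by rewrite /s mulrCA mulfV ?mulr1// gt_eqF.
rewrite powRM// ?(ltW AB)// ler_wpM2l ?powR_ge0//.
have wA : 0 <= A / (A + B) by rewrite divr_ge0// ltW.
have wB : 0 <= B / (A + B) by rewrite divr_ge0// ltW.
have Ha := ler_wpM2l wA (powR_tangent p1 s0 aA).
have Hb := ler_wpM2l wB (powR_tangent p1 s0 bB).
apply: le_trans (lerD Ha Hb); rewrite le_eqVlt; apply/orP; left; apply/eqP.
move: (s `^ p) (s `^ (p - 1)) => x y; rewrite /s; field.
by rewrite !gt_eqF.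
Qed.

End PowerFunction.

Section LpNorm.
Context {R : realType} {X : countType} (m : X -> R) (p : R).
Hypothesis m_gt0 : forall x, 0 < m x.
Hypothesis p_ge1 : 1 <= p.
Implicit Types (f g h : X -> R[i]) (s : seq X).

Let p_gt0 : 0 < p. Proof. exact: lt_le_trans p_ge1. Qed.

(** The l^p norm is the supremum of its restrictions to finite sets, so that norm
    inequalities need only be proved for finite sums, where everything is real. *)
Definition fin_lpnorm s f := (\sum_(x <- s) normc (f x) `^ p * m x) `^ p^-1.

Lemma fin_lpsum_ge0 s f : 0 <= \sum_(x <- s) normc (f x) `^ p * m x.
Proof. by apply: sumr_ge0 => x _; rewrite mulr_ge0 ?powR_ge0// ltW. Qed.

Lemma fin_lpnorm_ge0 s f : 0 <= fin_lpnorm s f.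
Proof. exact: powR_ge0. Qed.

Lemma fin_lpnorm_nil f : fin_lpnorm [::] f = 0.
Proof. by rewrite /fin_lpnorm big_nil powR0// invr_neq0// gt_eqF. Qed.

Lemma fin_lpnormK s f :
  fin_lpnorm s f `^ p = \sum_(x <- s) normc (f x) `^ p * m x.
Proof. by rewrite /fin_lpnorm powRVK// fin_lpsum_ge0. Qed.

Lemma lpterm_ge0 f x : 0 <= normc (f x) `^ p * m x.
Proof. by rewrite mulr_ge0 ?powR_ge0// ltW. Qed.

Lemma lpnorm_mono f g :
  (nsum (fun x => normc (f x) `^ p * m x)%R <=
   nsum (fun x => normc (g x) `^ p * m x)%R)%E ->
  (lpnorm m p f <= lpnorm m p g)%E.
Proof.
move=> fg; rewrite /lpnorm; apply: gt0_ler_poweR => //.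
- by rewrite invr_ge0 ltW.
- by rewrite in_itv/= leey nsum_ge0// => x; exact: lpterm_ge0.
- by rewrite in_itv/= leey nsum_ge0// => x; exact: lpterm_ge0.
Qed.

Lemma lpnorm_le_nsum f (M : R) : 0 <= M ->
  (nsum (fun x => normc (f x) `^ p * m x)%R <= (M `^ p)%:E)%E ->
  (lpnorm m p f <= M%:E)%E.
Proof.
move=> M0 fM; rewrite /lpnorm -(powRKV p_gt0 M0) -poweR_EFin.
apply: gt0_ler_poweR => //.
- by rewrite invr_ge0 ltW.
- by rewrite in_itv/= leey nsum_ge0// => x; exact: lpterm_ge0.
- by rewrite in_itv/= leey lee_fin powR_ge0.
Qed.

Lemma lpnorm_leP f (M : \bar R) : 
  (forall s, uniq s -> ((fin_lpnorm s f)%:E <= M)%E) <-> (lpnorm m p f <= M)%E.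
Proof.
have ip0 : 0 < p^-1 by rewrite invr_gt0.
split=> [|H s us]; last first.
  apply: le_trans H; rewrite /lpnorm -poweR_EFin gt0_ler_poweR//.
  - exact: ltW.
  - by rewrite in_itv/= leey lee_fin fin_lpsum_ge0.
  - by rewrite in_itv/= leey nsum_ge0// => x; exact: lpterm_ge0.
  - exact: nsum_ge.
case: M => [M H||/(_ [::] isT)//]; last by rewrite leey.
have M0 : 0 <= M by have := H [::] isT; rewrite fin_lpnorm_nil.
apply: lpnorm_le_nsum => //; apply: nsum_le => s us; rewrite lee_fin -fin_lpnormK.
by apply: ge0_ler_powR; rewrite ?nnegrE ?fin_lpnorm_ge0 ?(ltW p_gt0)// -lee_fin H.
Qed.

Lemma fin_lpnorm_le s f : uniq s -> ((fin_lpnorm s f)%:E <= lpnorm m p f)%E.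
Proof. by move=> us; have /lpnorm_leP := lexx (lpnorm m p f); exact. Qed.

Lemma fin_lpnormD_le s f g (A B : R) : 0 < A -> 0 < B ->
  fin_lpnorm s f <= A -> fin_lpnorm s g <= B ->
  fin_lpnorm s (fun x => f x + g x) <= A + B.
Proof.
move=> A0 B0 fA gB; have AB : 0 < A + B by rewrite addr_gt0.
apply: (powR_le_cancel p_gt0 (fin_lpnorm_ge0 _ _) (ltW AB)).
rewrite fin_lpnormK.
have step x : normc (f x + g x) `^ p * m x <= (A + B) `^ p *
   (A / (A + B) * (A `^ p)^-1 * (normc (f x) `^ p * m x)
    + B / (A + B) * (B `^ p)^-1 * (normc (g x) `^ p * m x)).
  apply: (@le_trans _ _ ((normc (f x) + normc (g x)) `^ p * m x)).
    rewrite ler_wpM2r ?(ltW (m_gt0 x))// ge0_ler_powR ?nnegrE ?(ltW p_gt0)//.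
      by rewrite addr_ge0.
    exact: normcD_le.
  have := convex_powR_scaled p_ge1 A0 B0 (normc_ge0 (f x)) (normc_ge0 (g x)).
  move=> /(ler_wpM2r (ltW (m_gt0 x))) /le_trans; apply.
  rewrite !powR_div ?(ltW A0) ?(ltW B0)//.
  by apply: le_of_eq; ring.
apply: (le_trans (ler_sum _ (fun x _ => step x))).
rewrite -mulr_sumr big_split/= -!mulr_sumr -!fin_lpnormK.
rewrite -[leRHS]mulr1 ler_wpM2l ?powR_ge0//.
have -> : 1 = A / (A + B) + B / (A + B) by field; rewrite gt_eqF.
have contract C D : 0 < C -> 0 <= D -> D <= C -> 
    C / (A + B) * (C `^ p)^-1 * D `^ p <= C / (A + B).
  move=> C0 D0 DC; rewrite -mulrA -[leRHS]mulr1 ler_wpM2l//.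
    by rewrite divr_ge0// ltW.
  rewrite ler_pdivrMl ?powR_gt0// mulr1.
  by apply: ge0_ler_powR; rewrite ?nnegrE ?(ltW p_gt0)// ltW.
by apply: lerD; apply: contract => //; exact: fin_lpnorm_ge0.
Qed.

Lemma fin_lpnormD s f g :
  fin_lpnorm s (fun x => f x + g x) <= fin_lpnorm s f + fin_lpnorm s g.
Proof.
apply/ler_addgt0Pr => e e0; have e2 : 0 < e / 2 by rewrite divr_gt0.
rewrite (splitr e) addrACA; apply: fin_lpnormD_le.
- by rewrite ltr_wpDl// fin_lpnorm_ge0.
- by rewrite ltr_wpDl// fin_lpnorm_ge0.
- by rewrite lerDl ltW.
- by rewrite lerDl ltW.
Qed.

Lemma lpnorm_ge0 f : (0 <= lpnorm m p f)%E.
Proof. by have := fin_lpnorm_le f (isT : uniq [::]); rewrite fin_lpnorm_nil. Qed.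

Lemma lpnormK f : in_lp m p f -> (fine (lpnorm m p f))%:E = lpnorm m p f.
Proof. by move=> fp; rewrite fineK// ge0_fin_numE// lpnorm_ge0. Qed.

Lemma lpnormD f g :
  (lpnorm m p (fun x => f x + g x)%R <= lpnorm m p f + lpnorm m p g)%E.
Proof.
apply/lpnorm_leP => s us; apply: (@le_trans _ _ (fin_lpnorm s f + fin_lpnorm s g)%:E).
  by rewrite lee_fin fin_lpnormD.
by rewrite EFinD leeD ?fin_lpnorm_le.
Qed.

Lemma lpnormZ f (k : R[i]) :
  lpnorm m p (fun x => k * f x) = ((normc k)%:E * lpnorm m p f)%E.
Proof.
rewrite /lpnorm -[normc k](powRKV p_gt0)//.
rewrite -poweR_EFin -poweRM ?lee_fin ?powR_ge0//; last first.
  by apply: nsum_ge0 => x; exact: lpterm_ge0.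
congr (_ `^ _)%E; rewrite -nsumZ ?powR_ge0//; last by move=> x; exact: lpterm_ge0.
by apply: eq_nsum => x; rewrite normcM powRM// mulrA.
Qed.

Lemma lpnormN f : lpnorm m p (fun x => - f x) = lpnorm m p f.
Proof.
by rewrite /lpnorm; congr (_ `^ _)%E; apply: eq_nsum => x; rewrite normc_opp.
Qed.

Lemma lpnormB f g :
  (lpnorm m p (fun x => f x - g x)%R <= lpnorm m p f + lpnorm m p g)%E.
Proof. by rewrite -(lpnormN g); exact: lpnormD. Qed.

Lemma lpnorm0 : lpnorm m p (fun _ => 0) = 0%E.
Proof.
have := lpnormZ (fun _ => 0) 0; rewrite normc_zero mul0e => <-.
by congr lpnorm; apply/funext => x; rewrite mul0r.
Qed.

Lemma in_lp0 : in_lp m p (fun _ => 0).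
Proof. by rewrite /in_lp lpnorm0 ltry. Qed.

Lemma in_lpD f g : in_lp m p f -> in_lp m p g -> in_lp m p (fun x => f x + g x).
Proof. by move=> fp gp; apply: le_lt_trans (lpnormD _ _) _; exact: lte_add_pinfty. Qed.

Lemma in_lpZ f (k : R[i]) : in_lp m p f -> in_lp m p (fun x => k * f x).
Proof. by move=> fp; rewrite /in_lp lpnormZ -lpnormK// -EFinM ltry. Qed.

Lemma in_lpB f g : in_lp m p f -> in_lp m p g -> in_lp m p (fun x => f x - g x).
Proof. by move=> fp gp; apply: le_lt_trans (lpnormB _ _) _; exact: lte_add_pinfty. Qed.

Lemma in_lp_le f (M : R) : (lpnorm m p f <= M%:E)%E -> in_lp m p f.
Proof. by move=> /le_lt_trans; apply; exact: ltry. Qed.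

Lemma normc_le_lpnorm f x : ((normc (f x) * m x `^ p^-1)%:E <= lpnorm m p f)%E.
Proof.
have := fin_lpnorm_le f (isT : uniq [:: x]).
by rewrite /fin_lpnorm big_seq1 powRM ?powR_ge0 ?powRKV// ltW.
Qed.

Lemma normc_le_point f x (M : R) : (lpnorm m p f <= M%:E)%E ->
  normc (f x) <= (m x `^ p^-1)^-1 * M.
Proof.
move=> fM; rewrite ler_pdivlMl ?powR_gt0// mulrC -lee_fin.
exact: le_trans (normc_le_lpnorm _ _) fM.
Qed.

Lemma lpnorm_eq0 f : (lpnorm m p f <= 0)%E -> f = fun _ => 0.
Proof.
move=> f0; apply/funext => x; apply: (@eq0_normc R); apply/eqP.
by rewrite eq_le normc_ge0 andbT; have := normc_le_point x f0; rewrite mulr0.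
Qed.

Lemma fin_lpnorm_small s f (e : R) : 0 <= e -> (forall x, x \in s -> normc (f x) <= e) ->
  fin_lpnorm s f <= e * (\sum_(x <- s) m x) `^ p^-1.
Proof.
move=> e0 fe; have S0 : 0 <= \sum_(x <- s) m x.
  by apply: sumr_ge0 => x _; exact: ltW.
rewrite -[X in _ <= X * _](powRKV p_gt0 e0) -powRM ?powR_ge0//.
apply: ge0_ler_powR; rewrite ?nnegrE ?invr_ge0 ?(ltW p_gt0) ?fin_lpsum_ge0//.
  by rewrite mulr_ge0 ?powR_ge0.
rewrite mulr_sumr big_seq [leRHS]big_seq; apply: ler_sum => x xs.
by rewrite ler_wpM2r ?(ltW (m_gt0 x))// ge0_ler_powR ?nnegrE ?(ltW p_gt0)// fe.
Qed.

(** Fatou's lemma: on a finite set, functions that are uniformly close have close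
    norms, so that a bound on the approximations passes to the limit there. *)
Lemma lpnorm_le_pointwise f (M : R) :
  (forall s (e : R), 0 < e -> exists2 g, (lpnorm m p g <= M%:E)%E &
     forall x, x \in s -> normc (f x - g x) <= e) ->
  (lpnorm m p f <= M%:E)%E.
Proof.
move=> fg; apply/lpnorm_leP => s us; rewrite lee_fin.
apply/ler_addgt0Pr => e e0; set C := (\sum_(x <- s) m x) `^ p^-1.
have C0 : 0 <= C by exact: powR_ge0.
have C1 : 0 < C + 1 by rewrite ltr_wpDl.
have [g gM ge] := fg s (e / (C + 1)) (divr_gt0 e0 C1).
have -> : f = fun x => (f x - g x) + g x by apply/funext => x; rewrite subrK.
apply: le_trans (fin_lpnormD _ _ _) _; rewrite addrC; apply: lerD.
  by rewrite -lee_fin; apply: le_trans gM; exact: fin_lpnorm_le.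
apply: le_trans (fin_lpnorm_small _ ge) _; first by rewrite ltW// divr_gt0.
rewrite -/C mulrAC ler_pdivrMr// ler_pM2l// lerDl; exact: ler01.
Qed.

End LpNorm.

(** * Strict contractions and resolvents *)

Section GeometricLimits.
Context {R : realType}.

(** The intervals of radius [e n] around [u n] pairwise intersect, hence have a
    common point. *)
Lemma common_point (u e : nat -> R) : (forall n, 0 <= e n) ->
  (forall n k, `|u (n + k)%N - u n| <= e n) ->
  exists l, forall n, `|l - u n| <= e n.
Proof.
move=> e0 ue; pose E := [set u n - e n | n in [set: nat]].
have EU n : ubound E (u n + e n).
  move=> _ [k _ <-]; have [nk|kn] := leqP n k.
    have := ue n (k - n)%N; rewrite subnKC// ler_norml => /andP[_ H].
    by have := e0 k; move: H; lra.
  have := ue k (n - k)%N; rewrite subnKC ?(ltnW kn)// ler_norml => /andP[H _].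
  by have := e0 n; move: H; lra.
have supE : has_sup E.
  by split; [exists (u 0%N - e 0%N); exists 0%N|exists (u 0%N + e 0%N)].
exists (sup E) => n; rewrite ler_distl; apply/andP; split.
  by apply: (ub_le_sup supE.2); exists n.
by apply: ge_sup; [exact: supE.1|exact: EU].
Qed.

(** The factor [2] pays for treating the real and imaginary parts separately. *)
Lemma common_pointC (z : nat -> R[i]) (e : nat -> R) : (forall n, 0 <= e n) ->
  (forall n k, normc (z (n + k)%N - z n) <= e n) ->
  exists w, forall n, normc (w - z n) <= 2 * e n.
Proof.
move=> e0 ze.
have [a aP] := @common_point (fun n => complex.Re (z n)) e e0 (fun n k =>
  le_trans (eq_ind _ (fun r => `|r| <= _) (ler_Re_normc _) _
    (etrans (Re_addc _ _) (congr1 (+%R _) (Re_oppc _)))) (ze n k)).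
have [c cP] := @common_point (fun n => complex.Im (z n)) e e0 (fun n k =>
  le_trans (eq_ind _ (fun r => `|r| <= _) (ler_Im_normc _) _
    (etrans (Im_addc _ _) (congr1 (+%R _) (Im_oppc _)))) (ze n k)).
exists (a +i* c) => n; apply: le_trans (ler_normc_ReIm _) _.
by rewrite Re_addc Re_oppc Im_addc Im_oppc /= mulrDl mul1r lerD.
Qed.

Lemma geometric_small (q C e : R) : 0 <= q < 1 -> 0 < e ->
  exists n, C * q ^+ n <= e.
Proof.
move=> /andP[q0 q1] e0.
have H : C * q ^+ n @[n --> \oo] --> C * 0.
  by apply: cvgM; [exact: cvg_cst|apply: cvg_expr; rewrite ger0_norm].
move/cvgrPdist_le : H => /(_ _ e0)[N _ /(_ N (leqnn N))].
rewrite mulr0 sub0r normrN => HN; exists N.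
exact: le_trans (ler_norm _) HN.
Qed.

End GeometricLimits.

Section ContractionResolvent.
Context {R : realType} {X : countType} (m : X -> R) (p : R).
Hypothesis m_gt0 : forall x, 0 < m x.
Hypothesis p_ge1 : 1 <= p.
Implicit Types (f g h : X -> R[i]).

Section FixedPoint.
Variables (B : (X -> R[i]) -> X -> R[i]) (q : R).
Hypothesis q01 : 0 <= q < 1.
Hypothesis B_sub : forall f g, in_lp m p f -> in_lp m p g ->
  B (fun x => f x - g x) = (fun x => B f x - B g x).
Hypothesis B_le : forall f, in_lp m p f ->
  (lpnorm m p (B f) <= q%:E * lpnorm m p f)%E.

Let q0 : 0 <= q. Proof. by case/andP: q01. Qed.
Let q1 : 0 < 1 - q. Proof. by case/andP: q01; rewrite subr_gt0. Qed.

Lemma contraction_le f (M : R) : (lpnorm m p f <= M%:E)%E ->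
  (lpnorm m p (B f) <= (q * M)%:E)%E.
Proof.
move=> fM; apply: le_trans (B_le (in_lp_le fM)) _.
by rewrite EFinM lee_wpmul2l// lee_fin.
Qed.

(** The Neumann series for [(1 - B)^-1 g]; its partial sums converge pointwise
    since point evaluations are bounded on l^p, and then in norm since closed
    balls are closed under pointwise limits. *)
Lemma contraction_solve g : in_lp m p g ->
  exists2 f, in_lp m p f & f = (fun x => g x + B f x).
Proof.
move=> gp; have gE := lpnormK m_gt0 p_ge1 gp.
move: (fine _) gE => G gE.
have G0 : 0 <= G by rewrite -lee_fin gE lpnorm_ge0.
pose M := G / (1 - q); have M0 : 0 <= M by rewrite divr_ge0// ltW.
have ME : G + q * M = M by rewrite /M; field; rewrite gt_eqF.
pose F := fix F n : X -> R[i] :=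
  if n is k.+1 then (fun x => g x + B (F k) x) else (fun _ => 0).
have FM n : (lpnorm m p (F n) <= M%:E)%E.
  elim: n => [|n IH]; first by rewrite lpnorm0// lee_fin.
  apply: le_trans (lpnormD _ _ _ _) _ => //.
  by rewrite -ME EFinD -gE leeD// contraction_le.
have Fp n : in_lp m p (F n) by exact: in_lp_le (FM n).
have Fdist n k : (lpnorm m p (fun x => F (n + k)%N x - F n x)%R <= (M * q ^+ n)%:E)%E.
  elim: n => [|n IH].
    rewrite add0n expr0 mulr1 (_ : (fun x => _) = F k)//.
    by apply/funext => x; rewrite subr0.
  rewrite (_ : (fun x => _) = B (fun x => F (n + k)%N x - F n x)); last first.
    by rewrite B_sub//; apply/funext => x; rewrite /= opprD addrACA subrr add0r.
  by apply: le_trans (contraction_le IH) _; rewrite exprS mulrCA.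
pose c x := (m x `^ p^-1)^-1.
have c0 x : 0 <= c x by rewrite invr_ge0 powR_ge0.
have /choice[w wP] x : exists w, forall n, normc (w - F n x) <= 2 * (c x * (M * q ^+ n)).
  apply: (@common_pointC _ (fun n => F n x) (fun n => c x * (M * q ^+ n))) => [n|n k].
    by rewrite mulr_ge0// mulr_ge0// exprn_ge0.
  exact: normc_le_point (Fdist n k).
have wF n : (lpnorm m p (fun x => w x - F n x)%R <= (M * q ^+ n)%:E)%E.
  apply: lpnorm_le_pointwise => // s e e0.
  have [k kP] := geometric_small (\sum_(x <- s) 2 * (c x * M)) q01 e0.
  exists (fun x => F (n + k)%N x - F n x) => // x xs.
  rewrite opprB addrA subrK; apply: le_trans (wP x _) (le_trans _ kP).
  apply: (@le_trans _ _ (2 * (c x * M) * q ^+ k)); last first.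
    rewrite ler_wpM2r ?exprn_ge0// (big_rem x xs)/= lerDl sumr_ge0// => y _.
    by rewrite mulr_ge0// mulr_ge0.
  rewrite -(mulrA 2) -(mulrA (c x)).
  apply: ler_wpM2l => //; apply: ler_wpM2l => //; apply: ler_wpM2l => //.
  rewrite exprD; apply: ler_piMl; first exact: exprn_ge0.
  by rewrite exprn_ile1//; case/andP: q01 => _ /ltW.
have wp : in_lp m p w.
  rewrite (_ : w = fun x => (w x - F 0%N x) + F 0%N x).
    by apply: in_lpD => //; exact: in_lp_le (wF 0%N).
  by apply/funext => x; rewrite subrK.
exists w => //; pose d x := w x - (g x + B w x).
suff dE : d = fun _ => 0.
  apply/funext => x; apply/eqP; rewrite -subr_eq0; apply/eqP.
  exact: (congr1 (fun h => h x) dE).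
apply: (lpnorm_eq0 m_gt0 p_ge1); apply/lee_addgt0Pr => e e0; rewrite add0e.
have [n nP] := geometric_small (2 * M) q01 e0.
apply: le_trans (_ : ((M * q ^+ n)%:E + (M * q ^+ n)%:E <= e%:E)%E); last first.
  by rewrite -EFinD lee_fin; apply: le_trans nP; rewrite -mulrA mulrDl mul1r.
have -> : d = fun x => (w x - F n.+1 x) - B (fun x => w x - F n x) x.
  rewrite B_sub//; apply/funext => x; rewrite /d /=; ring.
have q1' : q <= 1 by case/andP: q01 => _ /ltW.
have Mq0 : 0 <= M * q ^+ n by rewrite mulr_ge0 ?exprn_ge0.
have Mq : q * (M * q ^+ n) <= M * q ^+ n by exact: ler_piMl.
apply: le_trans (lpnormB m_gt0 p_ge1 _ _) _; apply: leeD.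
  by apply: le_trans (wF n.+1) _; rewrite lee_fin exprS mulrCA.
by apply: le_trans (contraction_le (wF n)) _; rewrite lee_fin.
Qed.

End FixedPoint.

(** [L - lambda] is inverted by the Neumann series as soon as some
    [1 - s (L - lambda)], [s != 0], is a strict contraction. *)
Lemma resolvent_of_contraction (A : operator R X) (L : (X -> R[i]) -> X -> R[i])
    (lambda s : R[i]) (q : R) :
  (forall f g, A f g <-> in_lp m p f /\ g = L f) ->
  (forall f g, in_lp m p f -> in_lp m p g ->
    L (fun x => f x - g x) = (fun x => L f x - L g x)) ->
  s != 0 -> 0 <= q < 1 ->
  (forall f, in_lp m p f ->
    (lpnorm m p (fun x => f x - s * (L f x - lambda * f x))%R
       <= q%:E * lpnorm m p f)%E) ->
  resolvent_set m p A lambda.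
Proof.
move=> AE Lsub s0 q01 Bq.
pose B f x := f x - s * (L f x - lambda * f x).
have Bsub f g : in_lp m p f -> in_lp m p g ->
    B (fun x => f x - g x) = (fun x => B f x - B g x).
  by move=> fp gp; apply/funext => x; rewrite /B Lsub//; ring.
have [q0 q1] := andP q01; have q1' : 0 < 1 - q by rewrite subr_gt0.
split.
  move=> g gp.
  have [f fp fE] := contraction_solve q01 Bsub Bq (in_lpZ m_gt0 p_ge1 s gp).
  exists f; split.
    apply/AE; split=> //; apply/funext => x.
    have /(congr1 (fun h => h x)) := fE; rewrite /B => E.
    apply: (mulfI s0); apply/eqP; rewrite -subr_eq0; apply/eqP.
    rewrite -[RHS](subrr (f x)) {2}E; ring.
  move=> f' /AE[f'p f'E].
  have fd : (fun x => f x - f' x) = B (fun x => f x - f' x).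
    rewrite Bsub//; apply/funext => x.
    have /(congr1 (fun h => h x)) := fE; have /(congr1 (fun h => h x)) := f'E.
    rewrite /B => E1 E2; rewrite {1}E2 -E1; ring.
  have dp := in_lpB m_gt0 p_ge1 fp f'p.
  have := Bq _ dp; rewrite -/(B (fun x => f x - f' x)) -fd.
  rewrite -(lpnormK m_gt0 p_ge1 dp) -EFinM lee_fin => H.
  have d0 : (lpnorm m p (fun x => f x - f' x)%R <= 0)%E.
    rewrite -(lpnormK m_gt0 p_ge1 dp) lee_fin.
    move: (fine _) H => r H; rewrite -(ler_pM2l q1') mulr0; lra.
  apply/funext => x; apply/eqP; rewrite -subr_eq0; apply/eqP.
  exact: (congr1 (fun h => h x) (lpnorm_eq0 m_gt0 p_ge1 d0)).
exists (normc s / (1 - q)) => f h /AE[fp hE].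
have ns0 : 0 < normc s.
  rewrite lt_neqAle normc_ge0 andbT eq_sym; apply: contra s0 => /eqP.
  by move/(@eq0_normc R) => ->.
have K0 : 0 < normc s / (1 - q) by rewrite divr_gt0.
case: (ltP (lpnorm m p (fun x => h x - lambda * f x)) +oo%E) => [hp|]; last first.
  by rewrite leye_eq => /eqP ->; rewrite gt0_muley ?lte_fin// leey.
have H : (lpnorm m p f <= q%:E * lpnorm m p f +
    (normc s)%:E * lpnorm m p (fun x => h x - lambda * f x)%R)%E.
  rewrite -lpnormZ//; apply: le_trans (leeD (Bq _ fp) (lexx _)).
  apply: le_trans (lpnormD m_gt0 p_ge1 _ _).
  rewrite hE le_eqVlt; apply/orP; left; apply/eqP; congr lpnorm.
  by apply/funext => x; ring.
move: H; rewrite -(lpnormK m_gt0 p_ge1 fp) -(lpnormK m_gt0 p_ge1 hp).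
move: (fine _) (fine _) => r t; rewrite -!EFinM -EFinD !lee_fin => H.
by rewrite mulrAC ler_pdivlMr//; lra.
Qed.

End ContractionResolvent.

(** * The random walk operator *)

Section Jensen.
Context {R : realType} {I : choiceType}.

Lemma le_one_add_powR (p t : R) : 1 <= p -> 0 <= t -> t <= 1 + t `^ p.
Proof.
move=> p1 t0; have [t1|t1] := leP t 1.
  by apply: le_trans t1 _; rewrite lerDl powR_ge0.
by apply: le_trans (le1r_powR (ltW t1) p1) _; rewrite lerDr.
Qed.

(** Jensen's inequality: the tangent inequality at the mean is summed against
    the weights, and its linear part cancels. *)
Lemma jensen_nsum (w u : I -> R) (W p : R) : 1 <= p -> 0 < W ->
  (forall i, 0 <= w i) -> nsum w = W%:E -> (forall i, 0 <= u i) ->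
  (nsum (fun i => (w i * u i)%R) < +oo)%E ->
  (((fine (nsum (fun i => (w i * u i)%R)) / W) `^ p * W)%:E
     <= nsum (fun i => (w i * u i `^ p)%R))%E.
Proof.
move=> p1 W0 w0 wW u0 uoo; have p0 : 0 <= p by apply: le_trans p1.
have wu0 i : 0 <= w i * u i by rewrite mulr_ge0.
have := fine_nsumK wu0 uoo; move: (fine _) => S SE.
have S0 : 0 <= S by rewrite -lee_fin SE nsum_ge0.
pose s := S / W; have s0 : 0 <= s by rewrite divr_ge0// ltW.
pose k := p * s `^ (p - 1); have k0 : 0 <= k by rewrite mulr_ge0 ?powR_ge0.
have step i : s `^ p * w i + k * (w i * u i) <= w i * u i `^ p + k * s * w i.
  have /(ler_wpM2l (w0 i)) := powR_tangent p1 s0 (u0 i); rewrite -/k.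
  move: (s `^ p) (u i `^ p) => x y; rewrite -[X in is_true X -> _]subr_ge0 => H.
  by rewrite -subr_ge0; apply: (le_trans H); apply: le_of_eq; ring.
have a0 i : 0 <= s `^ p * w i by apply: mulr_ge0 => //; exact: powR_ge0.
have b0 i : 0 <= k * (w i * u i) by exact: mulr_ge0.
have c0 i : 0 <= w i * u i `^ p by apply: mulr_ge0 => //; exact: powR_ge0.
have ks0 : 0 <= k * s by exact: mulr_ge0.
have d0 i : 0 <= k * s * w i by exact: mulr_ge0.
have := le_nsum step; rewrite (nsumD a0 b0) (nsumD c0 d0).
rewrite (nsumZ (powR_ge0 s p) w0) (nsumZ k0 wu0) (nsumZ ks0 w0) wW -SE -!EFinM.
have -> : k * S = k * s * W by rewrite /s -mulrA mulfVK// gt_eqF.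
by rewrite -/s leeD2rE// mulrC.
Qed.

End Jensen.

Section Walk.
Context {R : realType} {X : countType} (m : X -> R) (b : X -> X -> R).
Hypothesis m_gt0 : forall x, 0 < m x.
Hypothesis b_ge0 : forall x y, 0 <= b x y.
Hypothesis b_sym : forall x y, b x y = b y x.
Hypothesis b_row : forall x, nsum (b x) = (m x)%:E.
Implicit Types (f g h : X -> R[i]).

Let m_ge0 x : 0 <= m x. Proof. exact: ltW. Qed.
Local Hint Resolve m_ge0 : core.

(** The transition operator of the random walk that jumps from [x] to [y] with
    probability [b x y / m x]. *)
Definition walk f (x : X) : R[i] := (m x)^-1%:C * csum (fun y => (b x y)%:C * f y).

Definition lap f (x : X) : R[i] := f x - walk f x.

Lemma b_le x y : b x y <= m y.
Proof. by rewrite b_sym -lee_fin -b_row; exact: nsum_ge1. Qed.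

Lemma row_sum (u : X -> R) : (forall x, 0 <= u x) ->
  nsum (fun e : X * X => (b e.1 e.2 * u e.1)%R) = nsum (fun x => (u x * m x)%R).
Proof.
move=> u0; rewrite nsum_pair; last by move=> e; rewrite mulr_ge0.
apply: eq_esum => x _; rewrite EFinM -b_row -nsumZ//.
by apply: eq_nsum => y; rewrite mulrC.
Qed.

Lemma col_sum (u : X -> R) : (forall x, 0 <= u x) ->
  nsum (fun e : X * X => (b e.1 e.2 * u e.2)%R) = nsum (fun x => (u x * m x)%R).
Proof.
by move=> u0; rewrite nsum_swap -row_sum//; apply: eq_nsum => -[x y] /=; rewrite b_sym.
Qed.

Section WalkOnLp.
Variable p : R.
Hypothesis p_ge1 : 1 <= p.
Let p_gt0 : 0 < p. Proof. exact: lt_le_trans p_ge1. Qed.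

Lemma in_lp_sum f : in_lp m p f -> (nsum (fun x => (normc (f x) `^ p * m x)%R) < +oo)%E.
Proof. by move=> fp; apply: (lty_poweRy _ fp); rewrite invr_neq0// gt_eqF. Qed.

Lemma walk_term_lty f x : in_lp m p f ->
  (nsum (fun y => (b x y * normc (f y))%R) < +oo)%E.
Proof.
move=> fp; apply: (@nsum_lty_le _ _ _ (fun y => b x y + normc (f y) `^ p * m y)).
  move=> y; apply: le_trans (ler_wpM2l (b_ge0 x y) (le_one_add_powR p_ge1 (normc_ge0 _))) _.
  by rewrite mulrDr mulr1 lerD2l mulrC ler_wpM2l ?powR_ge0// b_le.
apply: nsum_lty_D => // [y||]; first exact: lpterm_ge0.
  by rewrite b_row ltry.
exact: in_lp_sum.
Qed.

Lemma walk_term_summable f x : in_lp m p f ->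
  csummable (fun y => (b x y)%:C * f y).
Proof.
move=> /(walk_term_lty x); apply: nsum_lty_le => y.
by rewrite normcM normc_real ger0_norm.
Qed.

Lemma walkB f g : in_lp m p f -> in_lp m p g ->
  walk (fun x => f x - g x) = (fun x => walk f x - walk g x).
Proof.
move=> fp gp; apply/funext => x; rewrite /walk -mulrBr -csumB; first last.
- exact: walk_term_summable.
- exact: walk_term_summable.
by congr (_ * _); apply: eq_csum => y; rewrite mulrBr.
Qed.

Lemma normc_walk f x : in_lp m p f ->
  normc (walk f x) <= fine (nsum (fun y => (b x y * normc (f y))%R)) / m x.
Proof.
move=> fp; rewrite /walk normcM normc_real ger0_norm ?invr_ge0// mulrC.
rewrite ler_wpM2r ?invr_ge0//.
apply: le_trans (normc_csum (walk_term_summable x fp)) _.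
rewrite le_eqVlt; apply/orP; left; apply/eqP; congr fine; apply: eq_nsum => y.
by rewrite normcM normc_real ger0_norm.
Qed.

(** By Jensen, [|P f| ^ p <= P (|f| ^ p)] pointwise, and [P] preserves the
    [m]-mass of nonnegative functions. *)
Lemma lpnorm_walk f : in_lp m p f -> (lpnorm m p (walk f) <= lpnorm m p f)%E.
Proof.
move=> fp; apply: lpnorm_mono => //.
rewrite -(col_sum (fun x => powR_ge0 (normc (f x)) p)).
rewrite nsum_pair; last by move=> e; rewrite mulr_ge0 ?powR_ge0.
apply: le_esum => x _.
apply: (le_trans _ (jensen_nsum p_ge1 (m_gt0 x) (b_ge0 x) (b_row x)
  (fun y => normc_ge0 (f y)) (walk_term_lty x fp))).
rewrite lee_fin ler_wpM2r//; apply: ge0_ler_powR; rewrite ?nnegrE ?(ltW p_gt0)//.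
  rewrite divr_ge0//; apply/fine_ge0/nsum_ge0 => y; exact: mulr_ge0.
exact: normc_walk.
Qed.

Lemma in_lp_walk f : in_lp m p f -> in_lp m p (walk f).
Proof. by move=> fp; apply: le_lt_trans (lpnorm_walk fp) fp. Qed.

Lemma in_lp_lap f : in_lp m p f -> in_lp m p (lap f).
Proof. by move=> fp; apply: in_lpB => //; exact: in_lp_walk. Qed.

Lemma lapB f g : in_lp m p f -> in_lp m p g ->
  lap (fun x => f x - g x) = (fun x => lap f x - lap g x).
Proof.
move=> fp gp; apply/funext => x; rewrite /lap walkB//; ring.
Qed.

Lemma lpnorm_lap f : in_lp m p f ->
  (lpnorm m p (lap f) <= lpnorm m p f + lpnorm m p f)%E.
Proof.
by move=> fp; apply: le_trans (lpnormB _ _ _ _) _ => //; rewrite leeD// lpnorm_walk.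
Qed.

(** [|1 - lambda| > 1 >= |P|], so the Neumann series for
    [(1 - lambda) - P] converges. *)
Lemma resolvent_Re_lt0 (A : operator R X) (lambda : R[i]) :
  (forall f g, A f g <-> in_lp m p f /\ g = lap f) ->
  complex.Re lambda < 0 -> resolvent_set m p A lambda.
Proof.
move=> AE l0; pose k := 1 - lambda.
have k1 : 1 < normc k.
  apply: lt_le_trans (ler_Re_normc _); rewrite Re_addc Re_oppc /=.
  by apply: lt_le_trans (ler_norm _); rewrite ltrDl oppr_gt0.
have kn0 : k != 0.
  by apply: contraTN k1 => /eqP ->; rewrite normc_zero -leNgt ler01.
apply: (resolvent_of_contraction m_gt0 p_ge1 AE lapB (invr_neq0 kn0)
  (q := (normc k)^-1)).
  rewrite invr_ge0 normc_ge0/= invf_lt1//; exact: lt_trans k1.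
move=> f fp; rewrite (_ : (fun x => _) = fun x => k^-1 * walk f x); last first.
  apply/funext => x; rewrite /lap.
  have -> : f x - walk f x - lambda * f x = k * f x - walk f x by rewrite /k; ring.
  by rewrite mulrBr mulKf// opprB addrCA subrr addr0.
by rewrite lpnormZ// normcV lee_wpmul2l ?lee_fin ?invr_ge0// lpnorm_walk.
Qed.

End WalkOnLp.

(** Fubini: by symmetry of [b], its column sums are the [m y] as well. *)
Lemma mass_walk f : in_lp m 1 f ->
  csum (fun x => (m x)%:C * walk f x) = csum (fun x => (m x)%:C * f x).
Proof.
move=> f1; pose u (e : X * X) := (b e.1 e.2)%:C * f e.2.
have uoo : csummable u.
  apply: (@nsum_lty_le _ _ _ (fun e => b e.1 e.2 * normc (f e.2))) => [e|].
    by rewrite /u normcM normc_real ger0_norm.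
  rewrite (col_sum (fun x => normc_ge0 (f x))).
  apply: nsum_lty_le (in_lp_sum (lexx 1) f1) => x.
  by rewrite powRr1.
transitivity (csum u).
  rewrite csum_pair//; apply: eq_csum => x.
  by rewrite /walk mulrA -rmorphM mulfV ?gt_eqF//= mul1r.
rewrite csum_swap csum_pair; last exact: csummable_swap.
apply: eq_csum => y; rewrite /u /=.
have bE : nsum (fun x => b x y) = (m y)%:E.
  by rewrite -b_row; apply: eq_nsum => x; rewrite b_sym.
rewrite csumZr; last first.
  apply: (@nsum_lty_le _ _ _ (fun x => b x y)) => [x|]; last by rewrite bE ltry.
  by rewrite normc_real ger0_norm.
by rewrite csum_real rsum_pos// bE.
Qed.

End Walk.

(** * Finitely supported functions and square summability *)

Section Truncation.
Context {R : realType}.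

Lemma nsum_finite (I : choiceType) (u : I -> R) (A : set I) :
  (forall i, ~ A i -> u i = 0) -> nsum u = (\esum_(i in A) (u i)%:E)%E.
Proof.
move=> u0; rewrite [RHS]esum_mkcond; apply: eq_esum => i _.
by case: ifPn => // /negP iA; rewrite u0// => Ai; apply: iA; rewrite inE.
Qed.

Lemma nsum_finite_lty (I : choiceType) (u : I -> R) (A : set I) : finite_set A ->
  (forall i, 0 <= u i) -> (forall i, ~ A i -> u i = 0) -> (nsum u < +oo)%E.
Proof.
move=> finA u0 uA; rewrite (nsum_finite uA) esum_fset//.
  by rewrite fsbig_finite//= sumEFin ltry.
by move=> i _; rewrite lee_fin.
Qed.

Lemma nsum_tail (I : choiceType) (u : I -> R) (e : R) : (forall i, 0 <= u i) ->
  (nsum u < +oo)%E -> 0 < e ->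
  exists s : seq I, (nsum (fun i => if i \in s then 0 else u i) <= e%:E)%E.
Proof.
move=> u0 uoo e0; have := fine_nsumK u0 uoo; move: (fine _) => S SE.
have [s us sS] : exists2 s : seq I, uniq s & S - e < \sum_(i <- s) u i.
  apply: contrapT => /forall2NP H.
  have : (nsum u <= (S - e)%:E)%E.
    apply: nsum_le => s us; rewrite lee_fin leNgt; apply/negP.
    by case: (H s).
  by rewrite -SE lee_fin; lra.
exists s; pose v i := if i \in s then u i else 0.
pose w i := if i \in s then 0 else u i.
have v0 i : 0 <= v i by rewrite /v; case: ifP.
have w0 i : 0 <= w i by rewrite /w; case: ifP.
have uE : nsum u = (nsum v + nsum w)%E.
  rewrite -nsumD//; apply: eq_nsum => i; rewrite /v /w.
  by case: ifP; rewrite ?addr0 ?add0r.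
have woo : (nsum w < +oo)%E.
  by apply: nsum_lty_le uoo => i; rewrite /w; case: ifP.
have vS : ((S - e)%:E <= nsum v)%E.
  apply: le_trans (nsum_ge v us); rewrite lee_fin; apply: le_trans (ltW sS) _.
  apply: le_of_eq; rewrite big_seq [RHS]big_seq; apply: eq_bigr => i.
  by rewrite /v => ->.
move: uE vS; rewrite -SE -/(nsum w) -(fine_nsumK w0 woo).
case: (nsum v) => [r||]//; rewrite -?EFinD ?lee_fin => -[->].
by move: (fine _) => t; lra.
Qed.

Definition trunc (X : countType) (s : seq X) (f : X -> R[i]) x : R[i] :=
  if x \in s then f x else 0.

Lemma trunc_approx (X : countType) (m : X -> R) (p e : R) (f : X -> R[i]) :
  (forall x, 0 < m x) -> 1 <= p -> in_lp m p f -> 0 < e ->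
  exists s, (lpnorm m p (fun x => f x - trunc s f x)%R <= e%:E)%E.
Proof.
move=> m0 p1 fp e0; have p0 : 0 < p by apply: lt_le_trans p1.
have [|s sP] := nsum_tail (lpterm_ge0 p m0 f) (in_lp_sum p1 fp) (e := e `^ p).
  exact: powR_gt0.
exists s; apply: lpnorm_le_nsum => //; first exact: ltW.
apply: le_trans sP; apply: le_nsum => x; rewrite /trunc; case: ifP => _.
  by rewrite subrr normc_zero powR0 ?mul0r// gt_eqF.
by rewrite subr0.
Qed.

Lemma finitely_supported_trunc (X : countType) (s : seq X) f :
  finitely_supported (trunc s f).
Proof.
apply: (@sub_finite_set _ _ [set` s]) => // x /=; rewrite /trunc.
by case: ifP => //; rewrite eqxx.
Qed.

Lemma finitely_supported_in_lp (X : countType) (m : X -> R) (p : R) f :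
  1 <= p -> finitely_supported f -> (forall x, 0 < m x) -> in_lp m p f.
Proof.
move=> p1 ff; have p0 : 0 < p by apply: lt_le_trans p1.
move=> m0; apply: poweR_lty; apply: (nsum_finite_lty ff) => [x|x /= nx].
  exact: lpterm_ge0.
have -> : f x = 0 by apply/eqP; apply: contrapT => /negP.
by rewrite normc_zero powR0 ?mul0r// gt_eqF.
Qed.

End Truncation.

Section SquareIntegrable.
Context {R : realType} {X : countType} (m : X -> R).
Hypothesis m_gt0 : forall x, 0 < m x.
Implicit Types (f g h : X -> R[i]).

Definition sqsum f := nsum (fun x => (normc (f x) ^+ 2 * m x)%R).

Lemma sqterm_ge0 f x : 0 <= normc (f x) ^+ 2 * m x.
Proof. by rewrite mulr_ge0 ?exprn_ge0// ltW. Qed.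

Lemma sqsum_ge0 f : (0 <= sqsum f)%E.
Proof. by apply: nsum_ge0 => x; exact: sqterm_ge0. Qed.

Lemma lpnorm2E f : lpnorm m 2 f = (sqsum f `^ 2^-1)%E.
Proof.
by congr (_ `^ _)%E; apply: eq_nsum => x; rewrite powR_mulrn.
Qed.

Lemma lpnorm2_sqr f : (lpnorm m 2 f `^ 2)%E = sqsum f.
Proof. by rewrite lpnorm2E -poweRrM mulVf// poweRe1// sqsum_ge0. Qed.

Lemma in_l2P f : in_lp m 2 f <-> (sqsum f < +oo)%E.
Proof.
rewrite /in_lp lpnorm2E; split; last exact: poweR_lty.
by apply: lty_poweRy; rewrite invr_neq0.
Qed.

Lemma sqsumK f : in_lp m 2 f -> (fine (sqsum f))%:E = sqsum f.
Proof. by move=> /in_l2P; apply: fine_nsumK => x; exact: sqterm_ge0. Qed.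

Lemma lpnorm2_le f g (k : R) : 0 <= k ->
  (lpnorm m 2 g <= k%:E * lpnorm m 2 f)%E <-> (sqsum g <= (k ^+ 2)%:E * sqsum f)%E.
Proof.
move=> k0; have k20 : 0 <= k ^+ 2 by rewrite exprn_ge0.
have kE : (k%:E = (k ^+ 2)%:E `^ 2^-1)%E.
  by rewrite poweR_EFin powR12_sqrt// sqrtr_sqr ger0_norm.
have kf0 : (0 <= (k ^+ 2)%:E * sqsum f)%E by rewrite mule_ge0// sqsum_ge0.
rewrite !lpnorm2E {1}kE -poweRM ?sqsum_ge0//; split => H.
  have := @gt0_ler_poweR R 2 (ler0n _ _) (sqsum g `^ 2^-1)%E
    (((k ^+ 2)%:E * sqsum f) `^ 2^-1)%E.
  rewrite !in_itv/= !leey !poweR_ge0 -!poweRrM mulVf// !poweRe1 ?sqsum_ge0//.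
  exact.
by apply: gt0_ler_poweR; rewrite ?invr_ge0 ?in_itv/= ?leey ?sqsum_ge0 ?kf0.
Qed.

Lemma mul_le_sqr (a c : R) : a * c <= a ^+ 2 + c ^+ 2.
Proof. by have := sqr_ge0 (a - c); have := sqr_ge0 (a + c); nra. Qed.

Lemma inner_summable f g : in_lp m 2 f -> in_lp m 2 g ->
  csummable (fun x => f x * conjc (g x) * (m x)%:C).
Proof.
move=> /in_l2P f2 /in_l2P g2.
apply: nsum_lty_le (nsum_lty_D (sqterm_ge0 f) (sqterm_ge0 g) f2 g2) => x.
rewrite !normcM normc_conjc normc_real gtr0_norm// -mulrDl ler_wpM2r ?(ltW (m_gt0 x))//.
exact: mul_le_sqr.
Qed.

Lemma innerBl f g h : in_lp m 2 f -> in_lp m 2 g -> in_lp m 2 h ->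
  inner m (fun x => f x - g x) h = inner m f h - inner m g h.
Proof.
move=> f2 g2 h2; rewrite /inner -csumB; [|exact: inner_summable..].
by apply: eq_csum => x; rewrite !mulrBl.
Qed.

Lemma innerZl f h (k : R[i]) : in_lp m 2 f -> in_lp m 2 h ->
  inner m (fun x => k * f x) h = k * inner m f h.
Proof.
move=> f2 h2; rewrite /inner -csumZ; last exact: inner_summable.
by apply: eq_csum => x; rewrite !mulrA.
Qed.

Lemma inner_self f : inner m f f = (fine (sqsum f))%:C.
Proof.
rewrite /sqsum -rsum_pos; last by move=> x; exact: sqterm_ge0.
by rewrite -csum_real; apply: eq_csum => x; rewrite mul_conjc -rmorphM.
Qed.

Lemma inner_eq0 f : in_lp m 2 f -> inner m f f = 0 -> f = fun _ => 0.
Proof.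
move=> f2; rewrite inner_self => -[H].
apply: (lpnorm_eq0 m_gt0 (ler1n _ 2)).
by rewrite lpnorm2E -sqsumK// H poweR0r// invr_neq0.
Qed.

Lemma sqsum_sub_scaled f h (s : R) : in_lp m 2 f -> in_lp m 2 h ->
  sqsum (fun x => f x - s%:C * h x) =
  (fine (sqsum f) - 2 * s * complex.Re (inner m h f) + s ^+ 2 * fine (sqsum h))%:E.
Proof.
move=> f2 h2.
have d2 : in_lp m 2 (fun x => f x - s%:C * h x).
  by exact: (in_lpB m_gt0 (ler1n _ 2) f2 (in_lpZ m_gt0 (ler1n _ 2) _ h2)).
rewrite -sqsumK// /sqsum -!rsum_pos; try exact: sqterm_ge0.
have fs : rsummable (fun x => normc (f x) ^+ 2 * m x).
  move/in_l2P : f2; apply: nsum_lty_le => x; rewrite ger0_norm//; exact: sqterm_ge0.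
have hs : rsummable (fun x => normc (h x) ^+ 2 * m x).
  move/in_l2P : h2; apply: nsum_lty_le => x; rewrite ger0_norm//; exact: sqterm_ge0.
have ps := csummable_Re (inner_summable h2 f2).
rewrite /inner /= -(rsumZ _ ps) -(rsumZ _ hs) -rsumN.
rewrite -rsumD//; last exact/rsummableN/rsummableZ.
rewrite -rsumD; [|apply: rsummableD => //; exact/rsummableN/rsummableZ|exact: rsummableZ].
congr EFin; apply: eq_rsum => x; rewrite !normc_sqr.
case: (f x) (h x) => [a c] [a' c'] /=; ring.
Qed.

End SquareIntegrable.

(** * The Dirichlet form on l^2 *)

Section DirichletForm.
Context {R : realType} {X : countType} (m : X -> R) (b : X -> X -> R) (c : X -> R).
Hypothesis m_gt0 : forall x, 0 < m x.
Hypothesis b_ge0 : forall x y, 0 <= b x y.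
Hypothesis b_sym : forall x y, b x y = b y x.
Hypothesis b_row : forall x, nsum (b x) = (m x)%:E.
Hypothesis c_eq0 : forall x, c x = 0.
Implicit Types (f g h : X -> R[i]).

Let p2 : 1 <= 2 :> R. Proof. exact: ler1n. Qed.
Let m_ge0 x : 0 <= m x. Proof. exact: ltW. Qed.
Local Hint Resolve m_ge0 p2 : core.

Definition energy f :=
  nsum (fun e : X * X => (b e.1 e.2 * normc (f e.1 - f e.2) ^+ 2)%R).

Lemma energy_ge0 f : (0 <= energy f)%E.
Proof. by apply: nsum_ge0 => e; rewrite mulr_ge0 ?exprn_ge0. Qed.

Lemma edge_mass f : 
  nsum (fun e : X * X => (b e.1 e.2 * (normc (f e.1) ^+ 2 + normc (f e.2) ^+ 2))%R)
  = (sqsum m f + sqsum m f)%E.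
Proof.
have f0 x : 0 <= normc (f x) ^+ 2 by rewrite exprn_ge0.
rewrite /sqsum -{1}(row_sum b_ge0 b_row f0) -(col_sum b_ge0 b_sym b_row f0).
rewrite -nsumD; [|by move=> e; rewrite mulr_ge0..].
by apply: eq_nsum => e; rewrite mulrDr.
Qed.


Lemma energy_le f : in_lp m 2 f -> (energy f <= (4 * fine (sqsum m f))%:E)%E.
Proof.
move=> f2; have E : ((4 * fine (sqsum m f))%:E = 2%:E * (sqsum m f + sqsum m f))%E.
  have := sqsumK m_gt0 f2; move: (fine _) => N <-; rewrite -EFinD -EFinM.
  by congr EFin; ring.
rewrite E -edge_mass -nsumZ//; last first.
  by move=> e; rewrite mulr_ge0// addr_ge0 ?exprn_ge0.
apply: le_nsum => e; rewrite [leRHS]mulrCA ler_wpM2l// !normc_sqr Re_addc Re_oppc Im_addc Im_oppc.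
case: (f e.1) (f e.2) => [x y] [x' y'] /=.
rewrite -subr_ge0 (_ : _ - _ = (x + x') ^+ 2 + (y + y') ^+ 2); last by ring.
by rewrite addr_ge0 ?sqr_ge0.
Qed.

Lemma energy_lty f : in_lp m 2 f -> (energy f < +oo)%E.
Proof. by move=> /energy_le /le_lt_trans; apply; exact: ltry. Qed.

Lemma energyK f : in_lp m 2 f -> (fine (energy f))%:E = energy f.
Proof.
move=> /energy_lty; apply: fine_nsumK => e; first by rewrite mulr_ge0 ?exprn_ge0.
Qed.

Lemma qform_diagE f : qform_diag b c f = (2^-1%:E * energy f)%E.
Proof.
rewrite /qform_diag [X in (_ + X)%E]esum1 ?adde0//.
by move=> x _; rewrite c_eq0 mul0r.
Qed.

Section Green.
Variables (f h : X -> R[i]).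
Hypotheses (f2 : in_lp m 2 f) (h2 : in_lp m 2 h).

Let edge_term (i j : X * X -> X) (e : X * X) : R[i] :=
  (b e.1 e.2)%:C * (f (i e) * conjc (h (j e))).

Let edge_summable (i j : X * X -> X) :
  (forall e, i e = e.1 \/ i e = e.2) -> (forall e, j e = e.1 \/ j e = e.2) ->
  csummable (edge_term i j).
Proof.
move=> iP jP.
have gE g : (forall e : X * X, 
    0 <= b e.1 e.2 * (normc (g e.1) ^+ 2 + normc (g e.2) ^+ 2)).
  by move=> e; rewrite mulr_ge0// addr_ge0 ?exprn_ge0.
have goo g : in_lp m 2 g -> (nsum (fun e : X * X =>
    b e.1 e.2 * (normc (g e.1) ^+ 2 + normc (g e.2) ^+ 2))%R < +oo)%E.
  by move=> g2; rewrite edge_mass -(sqsumK m_gt0 g2) -EFinD ltry.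
apply: nsum_lty_le (nsum_lty_D (gE f) (gE h) (goo f f2) (goo h h2)) => e.
rewrite !normcM normc_real normc_conjc ger0_norm// -mulrDr ler_wpM2l//.
apply: le_trans (mul_le_sqr _ _) _; apply: lerD.
  by case: (iP e) => ->; rewrite ?lerDl ?lerDr exprn_ge0.
by case: (jP e) => ->; rewrite ?lerDl ?lerDr exprn_ge0.
Qed.

(** Green's formula. The product expands into four absolutely convergent double
    sums, which the symmetry of [b] identifies in pairs. *)
Lemma qform_lap : qform b c f h = inner m (lap m b f) h.
Proof.
pose t11 := edge_term fst fst; pose t22 := edge_term snd snd.
pose t12 := edge_term fst snd; pose t21 := edge_term snd fst.
have s11 : csummable t11 by apply: edge_summable; left.
have s22 : csummable t22 by apply: edge_summable; right.
have s12 : csummable t12 by apply: edge_summable; [left|right].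
have s21 : csummable t21 by apply: edge_summable; [right|left].
have e22 : csum t22 = csum t11.
  by rewrite csum_swap; apply: eq_csum => -[x y]; rewrite /t11 /t22 /edge_term/= b_sym.
have e12 : csum t12 = csum t21.
  by rewrite csum_swap; apply: eq_csum => -[x y]; rewrite /t12 /t21 /edge_term/= b_sym.
have e11 : csum t11 = inner m f h.
  rewrite csum_pair//; apply: eq_csum => x; rewrite /t11 /edge_term /=.
  have boo : csummable (fun y => (b x y)%:C).
    apply: (@nsum_lty_le _ _ _ (b x)) => [y|]; last by rewrite b_row ltry.
    by rewrite normc_real ger0_norm.
  by rewrite csumZr// csum_real rsum_pos// b_row/= mulrC.
have e21 : csum t21 = inner m (walk m b f) h.
  rewrite csum_pair//; apply: eq_csum => x; rewrite /t21 /edge_term /=.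
  under eq_csum do rewrite mulrA.
  rewrite csumZr; last exact: (walk_term_summable m_gt0 b_ge0 b_sym b_row p2).
  rewrite /walk mulrAC (mulrAC _ _ (m x)%:C) -rmorphM mulVf ?gt_eqF//.
  by rewrite rmorph1 mul1r.
have wp := in_lp_walk m_gt0 b_ge0 b_sym b_row p2 f2.
rewrite /lap innerBl// -e11 -e21 /qform.
rewrite [X in _ + X](_ : _ = 0) ?addr0; last first.
  rewrite -(csum0 (R := R) X); apply: eq_csum => x.
  by rewrite c_eq0 !mul0r.
have -> : csum (fun e : X * X => (b e.1 e.2)%:C * (f e.1 - f e.2) *
    (h e.1 - h e.2)^*) = csum t11 + csum t22 - (csum t12 + csum t21).
  rewrite -!csumD// -csumB; [|exact: csummableD..].
  apply: eq_csum => e; rewrite /t11 /t22 /t12 /t21 /edge_term conjE.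
  have -> : conjc (h e.1 - h e.2) = conjc (h e.1) - conjc (h e.2).
    by rewrite -!conjE rmorphB.
  by ring.
by rewrite e22 e12; field.
Qed.

End Green.

Lemma Re_inner_lap f : in_lp m 2 f ->
  complex.Re (inner m (lap m b f) f) = 2^-1 * fine (energy f).
Proof.
move=> f2; rewrite -qform_lap// /qform.
rewrite [X in _ + X](_ : _ = 0) ?addr0; last first.
  rewrite -(csum0 (R := R) X); apply: eq_csum => x.
  by rewrite c_eq0 !mul0r.
rewrite [csum _](_ : _ = (fine (energy f))%:C); last first.
  rewrite /energy -rsum_pos; last by move=> e; rewrite mulr_ge0 ?exprn_ge0.
  rewrite -csum_real; apply: eq_csum => e.
  by rewrite -mulrA conjE mul_conjc -rmorphM.
have -> : 2^-1 = (2^-1)%:C :> R[i] by rewrite fmorphV rmorph_nat.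
by rewrite -rmorphM.
Qed.

(** Jensen: [L f x] is the mean of [f x - f y] for the weights [b x y / m x]. *)
Lemma sqsum_lap_le f : in_lp m 2 f -> (sqsum m (lap m b f) <= energy f)%E.
Proof.
move=> f2; rewrite /sqsum /energy nsum_pair; last first.
  by move=> e; rewrite mulr_ge0 ?exprn_ge0.
apply: le_esum => x _; pose u y := f x - f y.
have woo := walk_term_summable m_gt0 b_ge0 b_sym b_row p2 x f2.
have boo : csummable (fun y => (b x y)%:C).
  apply: (@nsum_lty_le _ _ _ (b x)) => [y|]; last by rewrite b_row ltry.
  by rewrite normc_real ger0_norm.
have foo : csummable (fun y => (b x y)%:C * f x).
  by under eq_fun do rewrite mulrC; exact: csummableZ.
have uoo : csummable (fun y => (b x y)%:C * u y).
  rewrite (_ : (fun y => _) = fun y => (b x y)%:C * f x + - ((b x y)%:C * f y)).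
    by apply: csummableD => //; exact: csummableN.
  by apply/funext => y; rewrite /u mulrBr.
have lapE : lap m b f x = (m x)^-1%:C * csum (fun y => (b x y)%:C * u y).
  transitivity ((m x)^-1%:C * (csum (fun y => (b x y)%:C * f x) -
      csum (fun y => (b x y)%:C * f y))).
    rewrite csumZr// csum_real rsum_pos// b_row mulrBr mulrA -rmorphM.
    by rewrite mulVf ?gt_eqF// rmorph1 mul1r.
  by rewrite -csumB//; congr (_ * _); apply: eq_csum => y; rewrite mulrBr.
have nE : nsum (fun y => normc ((b x y)%:C * u y)) =
    nsum (fun y => b x y * normc (u y)).
  by apply: eq_nsum => y; rewrite normcM normc_real ger0_norm.
have := uoo; rewrite /csummable nE => uoo'.
have J := jensen_nsum p2 (m_gt0 x) (b_ge0 x) (b_row x) (fun y => normc_ge0 (u y)) uoo'.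
rewrite powR_mulrn in J; last first.
  by rewrite divr_ge0//; apply/fine_ge0/nsum_ge0 => y; rewrite mulr_ge0.
apply: le_trans (le_trans J _); last first.
  by apply: le_nsum => y; rewrite powR_mulrn.
rewrite lee_fin ler_wpM2r// lapE normcM normc_real ger0_norm ?invr_ge0//.
rewrite ler_pXn2r ?nnegrE ?mulr_ge0 ?invr_ge0//; last first.
  by apply/fine_ge0/nsum_ge0 => y; rewrite mulr_ge0.
rewrite mulrC ler_wpM2r ?invr_ge0//.
by apply: le_trans (normc_csum uoo) _; rewrite nE.
Qed.

(** The form is bounded by a multiple of the squared l^2 norm, so that truncations
    of [f] converge to [f] in the form norm as soon as they do in l^2. *)
Lemma qform_domainP f : qform_domain m b c f <-> in_lp m 2 f.
Proof.
split=> [/(_ 1 ltr01)[phi [fphi]]|f2 e e0].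
  rewrite /qnorm => H.
  have {}H : (qform_diag b c (f \- phi)%R + lpnorm m 2 (f \- phi)%R `^ 2 < +oo)%E.
    apply: (@lty_poweRy _ _ 2^-1); first by rewrite invr_neq0.
    by apply: lt_trans H _; exact: ltry.
  have d2 : in_lp m 2 (fun x => f x - phi x).
    apply/in_l2P => //; rewrite -(lpnorm2_sqr m_gt0); apply: le_lt_trans H.
    by rewrite leeDr// qform_diagE mule_ge0 ?lee_fin ?invr_ge0// energy_ge0.
  rewrite (_ : f = fun x => (f x - phi x) + phi x).
    apply: in_lpD => //; exact: finitely_supported_in_lp.
  by apply/funext => x; rewrite subrK.
have e2 : 0 < e / 2 by rewrite divr_gt0.
have [s sP] := trunc_approx m_gt0 p2 f2 e2.
exists (trunc s f); split; first exact: finitely_supported_trunc.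
rewrite -/(f \- trunc s f) in sP; move: (f \- _) sP => d dP.
have d2 := in_lp_le dP; have e20 := ltW e2.
have S : (sqsum m d <= ((e / 2) ^+ 2)%:E)%E.
  rewrite -(lpnorm2_sqr m_gt0) -powR_mulrn// -poweR_EFin; apply: gt0_ler_poweR => //.
    by rewrite in_itv/= leey (lpnorm_ge0 m_gt0 p2).
  by rewrite in_itv/= leey lee_fin (ltW e2).
have := energy_le d2; rewrite /qnorm qform_diagE (lpnorm2_sqr m_gt0).
have E0 := energy_ge0 d; have N0 := sqsum_ge0 m_gt0 d.
move: S E0 N0; rewrite -(energyK d2) -(sqsumK m_gt0 d2).
move: (fine _) (fine _) => E N; rewrite !lee_fin -EFinM -EFinD => NS E0 N0 EN.
rewrite [fine _]/= in EN.
rewrite poweR_EFin lte_fin -[X in _ < X](powRKV (ltr0n _ 2) (ltW e0)).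
have t0 : 0 <= 2^-1 * E + N by rewrite addr_ge0// mulr_ge0// invr_ge0.
apply: gt0_ltr_powR; [by rewrite invr_gt0|by rewrite nnegrE|by rewrite nnegrE powR_ge0|].
rewrite powR_mulrn; last exact: ltW.
have : 0 < e ^+ 2 by rewrite exprn_gt0.
by move: NS; rewrite exprMn; move: (e ^+ 2) => r; lra.
Qed.

(** By Green's formula [L f] satisfies the defining identity of the form
    Laplacian; it is the only such [g], as seen by testing with [h = g - L f]. *)
Lemma form_laplacianP f g :
  form_laplacian m b c f g <-> in_lp m 2 f /\ g = lap m b f.
Proof.
split=> [[/qform_domainP f2 g2 fg]|[f2 ->]]; last first.
  split; [exact/qform_domainP|exact: in_lp_lap|].
  by move=> h /qform_domainP h2; exact: qform_lap.
split=> //; have l2 := in_lp_lap m_gt0 b_ge0 b_sym b_row p2 f2.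
have d2 := in_lpB m_gt0 p2 g2 l2.
have : inner m (fun x => g x - lap m b f x) (fun x => g x - lap m b f x) = 0.
  rewrite innerBl// -fg; last exact/qform_domainP.
  by rewrite qform_lap// subrr.
move=> /(inner_eq0 m_gt0 d2) d0; apply/funext => x.
by apply/eqP; rewrite -subr_eq0; apply/eqP; exact: (congr1 (fun h => h x) d0).
Qed.

End DirichletForm.

(** * Lower bounds of the form and Cheeger's inequality *)

Section Gap.
Context {R : realType} {X : countType} (m : X -> R) (b : X -> X -> R) (c : X -> R).
Hypothesis m_gt0 : forall x, 0 < m x.
Hypothesis b_ge0 : forall x y, 0 <= b x y.
Hypothesis b_sym : forall x y, b x y = b y x.
Hypothesis b_row : forall x, nsum (b x) = (m x)%:E.
Hypothesis c_eq0 : forall x, c x = 0.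
Implicit Types (f g h : X -> R[i]).

Let p2 : 1 <= 2 :> R. Proof. exact: ler1n. Qed.
Local Hint Resolve p2 : core.

Lemma lpnorm_lap_sub f (lambda : R[i]) : in_lp m 2 f ->
  (lpnorm m 2 (fun x => lap m b f x - lambda * f x)%R
     <= (2 + normc lambda)%:E * lpnorm m 2 f)%E.
Proof.
move=> f2; apply: le_trans (lpnormB m_gt0 p2 _ _) _.
rewrite lpnormZ//; apply: le_trans (leeD (lpnorm_lap m_gt0 b_ge0 b_sym b_row p2 f2) (lexx _)) _.
rewrite -(lpnormK m_gt0 p2 f2) -!EFinM -!EFinD lee_fin.
by apply: le_of_eq; ring.
Qed.

(** A lower bound [kappa] for the form makes the gradient step
    [1 - s (L - lambda)] a strict contraction for small [s], whenever
    [Re lambda < kappa]. *)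
Lemma resolvent_below_gap (kappa : R) (A : operator R X) (lambda : R[i]) :
  (forall f, in_lp m 2 f -> 2 * kappa * fine (sqsum m f) <= fine (energy b f)) ->
  (forall f g, A f g <-> in_lp m 2 f /\ g = lap m b f) ->
  complex.Re lambda < kappa -> resolvent_set m 2 A lambda.
Proof.
move=> gap AE lk; pose d := kappa - complex.Re lambda.
have d0 : 0 < d by rewrite subr_gt0.
(* [2 + normc lambda] bounds the norm of [L - lambda]; adding [d] makes [C] at
   least [d], so that [1 - s * d] is nonnegative. The step [s = d / C ^+ 2]
   minimises [1 - 2 * s * d + s ^+ 2 * C ^+ 2]. *)
pose C := 2 + normc lambda + d.
have lC : 2 + normc lambda <= C by rewrite lerDl ltW.
have dC : d <= C by rewrite lerDr addr_ge0.
have C0 : 0 < C by exact: lt_le_trans dC.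
have [s [s0 sE]] : exists s, 0 < s /\ s = d / C ^+ 2.
  by exists (d / C ^+ 2); rewrite divr_gt0// exprn_gt0.
have r01 : 0 <= 1 - s * d < 1.
  rewrite gtrBl mulr_gt0// andbT subr_ge0 sE mulrAC -expr2 ler_pdivrMr ?exprn_gt0//.
  by rewrite mul1r ler_pXn2r ?nnegrE// ltW.
have /andP[r0 r1] := r01.
have q01 : 0 <= Num.sqrt (1 - s * d) < 1.
  by rewrite sqrtr_ge0/= -[X in _ < X]sqrtr1 ltr_sqrt.
have sn0 : s%:C != 0 :> R[i].
  by rewrite eq_complex /= eqxx andbT gt_eqF.
apply: (resolvent_of_contraction m_gt0 p2 AE
  (lapB m_gt0 b_ge0 b_sym b_row p2) sn0 q01).
move=> f f2; apply/(lpnorm2_le m_gt0); first exact: sqrtr_ge0.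
rewrite sqr_sqrtr//.
have hC := lpnorm_lap_sub lambda f2.
have h2 : in_lp m 2 (fun x => lap m b f x - lambda * f x).
  apply: le_lt_trans hC _; by rewrite -(lpnormK m_gt0 p2 f2) -EFinM ltry.
have /(lpnorm2_le m_gt0) hC2 : (lpnorm m 2 (fun x => lap m b f x - lambda * f x)%R
    <= C%:E * lpnorm m 2 f)%E.
  apply: le_trans hC _; rewrite -(lpnormK m_gt0 p2 f2) -!EFinM lee_fin.
  by rewrite ler_wpM2r// fine_ge0// lpnorm_ge0.
have {}hC2 := hC2 (ltW C0).
rewrite (sqsum_sub_scaled m_gt0 s f2 h2).
have l2 := in_lp_lap m_gt0 b_ge0 b_sym b_row p2 f2.
have Z2 := in_lpZ m_gt0 p2 lambda f2.
rewrite (innerBl m_gt0 l2 Z2 f2) (innerZl m_gt0 lambda f2 f2).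
rewrite inner_self// Re_addc Re_oppc (mulrC lambda) Re_realM.
rewrite (Re_inner_lap m_gt0 b_ge0 b_sym b_row c_eq0 f2).
have := gap _ f2; move: hC2.
have N0 : 0 <= fine (sqsum m f) by rewrite fine_ge0// sqsum_ge0.
have := sqsumK m_gt0 f2; have := sqsumK m_gt0 h2.
move: N0; move: (fine (energy b f)) => E.
move: (fine (sqsum m f)) (fine (sqsum m (fun x => lap m b f x - lambda * f x))).
move=> N H N0 <- <-; rewrite -!EFinM !lee_fin => HN EN; rewrite (mulrC N).
have I1 : d * N <= 2^-1 * E - complex.Re lambda * N by rewrite /d; lra.
have I2 : s ^+ 2 * H <= s * d * N.
  apply: (@le_trans _ _ (s ^+ 2 * (C ^+ 2 * N))).
    by rewrite ler_wpM2l// exprn_ge0// ltW.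
  have sC : s * C ^+ 2 = d by rewrite sE mulfVK// expf_neq0// gt_eqF.
  by apply: le_of_eq; rewrite -sC; ring.
have I3 := ler_wpM2l (ltW s0) I1; move: I3 I2.
move: (2^-1 * E - complex.Re lambda * N) => I I3 I2.
rewrite mulrBl mul1r; lra.
Qed.

End Gap.

Section Cheeger.
Context {R : realType} {X : countType} (m : X -> R) (b : X -> X -> R).
Hypothesis m_gt0 : forall x, 0 < m x.
Hypothesis b_ge0 : forall x y, 0 <= b x y.
Hypothesis b_sym : forall x y, b x y = b y x.
Hypothesis b_row : forall x, nsum (b x) = (m x)%:E.
Implicit Types (f : X -> R[i]) (g : X -> R) (s : seq X).

Let m_ge0 x : 0 <= m x. Proof. exact: ltW. Qed.
Local Hint Resolve m_ge0 : core.

Definition variation g :=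
  nsum (fun e : X * X => (b e.1 e.2 * `|g e.1 - g e.2|)%R).
Definition mass g := nsum (fun x => (g x * m x)%R).
Definition indic s x : R := (x \in s)%:R.

Lemma indic_ge0 s x : 0 <= indic s x.
Proof. exact: ler0n. Qed.

Lemma deg_setE s : deg_set b [set` s] = mass (indic s).
Proof.
rewrite /deg_set esum_mkcond; apply: eq_esum => x _.
by rewrite /indic /deg b_row /= mem_setE; case: (x \in s); rewrite ?mul1r ?mul0r.
Qed.

Lemma variation_indic s :
  variation (indic s) = (boundary_size b [set` s] + boundary_size b [set` s])%E.
Proof.
pose u (e : X * X) := b e.1 e.2 * (indic s e.1 * (1 - indic s e.2)).
have u0 e : 0 <= u e.
  by rewrite /u /indic !mulr_ge0//; case: (e.2 \in s); rewrite ?subrr ?subr0.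
have uE : boundary_size b [set` s] = nsum u.
  rewrite /boundary_size esum_mkcond; apply: eq_esum => -[x y] _ /=.
  rewrite in_setX in_setC !mem_setE /u /indic /=.
  by case: (x \in s) (y \in s) => [] []; rewrite /= ?subrr ?subr0 ?mulr1 ?mul0r ?mulr0.
rewrite uE {2}nsum_swap -(nsumD u0 (fun e => u0 (e.2, e.1))).
apply: eq_nsum => -[x y]; rewrite /u /= (b_sym y x) -mulrDr /indic.
have n01 (k l : bool) : `|k%:R - l%:R| = k%:R * (1 - l%:R) + l%:R * (1 - k%:R) :> R.
  by case: k l => [] []; rewrite ?(subrr, subr0, sub0r, normrN, normr0, normr1,
    mulr1, mulr0, addr0, add0r).
by rewrite n01.
Qed.

Lemma seq_argmin (T : eqType) (u : T -> R) (s : seq T) x : x \in s ->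
  exists2 x0, x0 \in s & forall y, y \in s -> u x0 <= u y.
Proof.
elim: s x => // a [|a' s] IH x _.
  by exists a; rewrite ?mem_head// => y; rewrite inE => /eqP ->.
have [x0 x0s x0P] := IH a' (mem_head _ _).
have [h|h] := leP (u a) (u x0).
  exists a; rewrite ?mem_head// => y; rewrite inE => /predU1P[-> //|/x0P].
  exact: le_trans.
exists x0; first by rewrite inE x0s orbT.
by move=> y; rewrite inE => /predU1P[->|/x0P//]; exact: ltW.
Qed.

Section Coarea.
Variable alpha : R.
Hypothesis alpha_ge0 : 0 <= alpha.
Hypothesis alphaP : forall W : set X, finite_set W ->
  (alpha%:E * deg_set b W <= boundary_size b W)%E.

(** Discrete co-area argument: subtracting from [g] its minimum [t] over [s] peels
    off a layer, [t] times the indicator of [s], and leaves a function supported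
    in a smaller set; [variation] and [mass] are additive along this
    decomposition. *)
Lemma coarea_finite s g : (forall x, 0 <= g x) -> (forall x, x \notin s -> g x = 0) ->
  ((2 * alpha)%:E * mass g <= variation g)%E.
Proof.
have [n] := ubnP (size s); elim: n s g => // n IH [|x1 s1] g + g0 gs.
  move=> _; rewrite /mass esum1 ?mule0.
    by apply: nsum_ge0 => e; rewrite mulr_ge0.
  by move=> x _; rewrite gs// mul0r.
move: (x1 :: s1) (mem_head x1 s1) gs => s x1s gs sn.
have [x0 x0s x0P] := seq_argmin g x1s.
pose t := g x0; pose g' x := if x \in s then g x - t else 0.
have t0 : 0 <= t by exact: g0.
have g'0 x : 0 <= g' x by rewrite /g'; case: ifP => // /x0P; rewrite subr_ge0.
have gE x : g x = t * indic s x + g' x.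
  rewrite /g' /indic; case: ifPn => [_|/gs ->]; last by rewrite mulr0 addr0.
  by rewrite mulr1 addrCA subrr addr0.
have i0 := indic_ge0 s.
have massE : mass g = (t%:E * mass (indic s) + mass g')%E.
  rewrite /mass -nsumZ//; last by move=> x; rewrite mulr_ge0.
  rewrite -nsumD; [|by move=> x; rewrite !mulr_ge0..].
  by apply: eq_nsum => x; rewrite gE mulrDl mulrA.
have varE : variation g = (t%:E * variation (indic s) + variation g')%E.
  rewrite /variation -nsumZ//; last by move=> e; rewrite mulr_ge0.
  rewrite -nsumD; [|by move=> e; rewrite !mulr_ge0..].
  apply: eq_nsum => -[x y] /=; rewrite mulrCA -mulrDr; congr (_ * _).
  rewrite /g' /indic; case: ifPn => [xs|/gs ->]; case: ifPn => [ys|/gs ->] /=.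
  - by rewrite subrr normr0 mulr0 add0r opprB addrA subrK.
  - rewrite !subr0 normr1 mulr1 !ger0_norm ?subr_ge0 ?x0P ?g0//.
    by rewrite addrC subrK.
  - rewrite !sub0r !normrN normr1 mulr1 !ger0_norm ?subr_ge0 ?x0P ?g0//.
    by rewrite addrC subrK.
  - by rewrite subrr normr0 mulr0 addr0.
have IHg' : ((2 * alpha)%:E * mass g' <= variation g')%E.
  apply: (IH [seq x <- s | x != x0]) => // [|x].
    rewrite -ltnS; apply: leq_trans sn; rewrite ltnS size_filter -(count_predC (pred1 x0) s).
    by rewrite -[X in (X < _)%N]add0n ltn_add2r -has_count has_pred1.
  rewrite mem_filter negb_and negbK /g' => /orP[/eqP ->|/negbTE -> //].
  by rewrite x0s subrr.
have IHi : ((2 * alpha)%:E * mass (indic s) <= variation (indic s))%E.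
  rewrite variation_indic -deg_setE mulrDl mul1r EFinD ge0_muleDl ?lee_fin//.
  by rewrite leeD// alphaP.
rewrite massE varE ge0_muleDr; first 1 last.
- by rewrite mule_ge0// nsum_ge0// => x; rewrite mulr_ge0.
- by rewrite nsum_ge0// => x; rewrite mulr_ge0.
by rewrite leeD// muleCA lee_wpmul2l.
Qed.

(** Cutting [g] down to a finite set that carries all of its mass but [e]
    raises the variation by at most [2 e]. *)
Lemma coarea g : (forall x, 0 <= g x) -> (mass g < +oo)%E ->
  ((2 * alpha)%:E * mass g <= variation g)%E.
Proof.
move=> g0 goo; apply/lee_addgt0Pr => e e0.
have k0 : 0 < 2 * alpha + 2 by rewrite ltr_wpDl// mulr_ge0.
have gm0 x : 0 <= g x * m x by rewrite mulr_ge0.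
have [s sP] := nsum_tail gm0 goo (divr_gt0 e0 k0).
pose g1 x := if x \in s then g x else 0; pose g2 x := if x \in s then 0 else g x.
have g10 x : 0 <= g1 x by rewrite /g1; case: ifP.
have g20 x : 0 <= g2 x by rewrite /g2; case: ifP.
have gE x : g x = g1 x + g2 x by rewrite /g1 /g2; case: ifP; rewrite ?addr0 ?add0r.
have m2P : (mass g2 <= (e / (2 * alpha + 2))%:E)%E.
  apply: le_trans sP; apply: le_nsum => x; rewrite /g2; case: ifP => //.
  by rewrite mul0r.
have massE : mass g = (mass g1 + mass g2)%E.
  rewrite /mass -nsumD; [|by move=> x; rewrite mulr_ge0..].
  by apply: eq_nsum => x; rewrite gE mulrDl.
have var1 : (variation g1 <= variation g + (mass g2 + mass g2))%E.
  rewrite /mass -{1}(row_sum b_ge0 b_row g20) -(col_sum b_ge0 b_sym b_row g20).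
  have v0 (e' : X * X) : 0 <= b e'.1 e'.2 * `|g e'.1 - g e'.2| by rewrite mulr_ge0.
  have r0 (e' : X * X) : 0 <= b e'.1 e'.2 * g2 e'.1 by rewrite mulr_ge0.
  have c0 (e' : X * X) : 0 <= b e'.1 e'.2 * g2 e'.2 by rewrite mulr_ge0.
  rewrite -(nsumD r0 c0) -(nsumD v0 (fun e' => addr_ge0 (r0 e') (c0 e'))).
  apply: le_nsum => x; rewrite -!mulrDr ler_wpM2l//.
  have -> : g1 x.1 - g1 x.2 = (g x.1 - g x.2) + (g2 x.2 - g2 x.1) by rewrite !gE; ring.
  apply: le_trans (ler_normD _ _) _; rewrite lerD2l.
  by apply: le_trans (ler_normB _ _) _; rewrite !ger0_norm// addrC.
have H : ((2 * alpha)%:E * mass g1 <= variation g1)%E.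
  by apply: (@coarea_finite s g1 g10) => x; rewrite /g1 => /negbTE ->.
have m20 : (0 <= mass g2)%E by rewrite nsum_ge0// => x; rewrite mulr_ge0.
rewrite massE ge0_muleDr//; last by rewrite nsum_ge0// => x; rewrite mulr_ge0.
apply: (le_trans (leeD (le_trans H var1) (lexx _))).
rewrite -addeA leeD2l//; move: m2P m20.
case: (mass g2) => [r| |]//; rewrite -EFinM -!EFinD !lee_fin => r1 _.
have := ler_wpM2l (ltW k0) r1; rewrite mulrCA mulfV ?mulr1 ?gt_eqF//.
by apply: le_trans; apply: le_of_eq; ring.
Qed.

(** Cheeger's inequality: the co-area inequality is applied to [|f| ^ 2], and the
    difference of squares [(|f x| - |f y|) (|f x| + |f y|)] is split by the
    arithmetic-geometric inequality, weighted by [alpha] so that the terms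
    in [|f| ^ 2] make up half of [2 * alpha] times the mass. *)
Lemma cheeger_inequality f : in_lp m 2 f ->
  alpha ^+ 2 * fine (sqsum m f) <= fine (energy b f).
Proof.
move=> f2; have EK := energyK m_gt0 b_ge0 b_sym b_row f2.
have NK := sqsumK m_gt0 f2.
have [->|an0] := eqVneq alpha 0.
  by rewrite expr0n mul0r -lee_fin EK; exact: energy_ge0.
have a0 : 0 < alpha by rewrite lt_neqAle eq_sym an0.
have ia0 : 0 < alpha^-1 by rewrite invr_gt0.
have g0 x : 0 <= normc (f x) ^+ 2 by rewrite exprn_ge0.
have := coarea g0; rewrite /mass -/(sqsum m f) => /(_ (iffLR (in_l2P m f) f2)) H.
pose u (e : X * X) := b e.1 e.2 * normc (f e.1 - f e.2) ^+ 2.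
pose v (e : X * X) := b e.1 e.2 * (normc (f e.1) ^+ 2 + normc (f e.2) ^+ 2).
have u0 e : 0 <= u e by rewrite mulr_ge0// exprn_ge0.
have v0 e : 0 <= v e by rewrite mulr_ge0// addr_ge0// exprn_ge0.
have step (e : X * X) : b e.1 e.2 * `|normc (f e.1) ^+ 2 - normc (f e.2) ^+ 2|
    <= alpha^-1 * u e + alpha / 2 * v e.
  rewrite /u /v ![_ * (b e.1 e.2 * _)]mulrCA -mulrDr ler_wpM2l//.
  have tri : `|normc (f e.1) - normc (f e.2)| <= normc (f e.1 - f e.2).
    rewrite ler_norml; apply/andP; split.
      rewrite lerNl opprB lerBlDr normc_dist.
      by apply: le_trans (normcD_le _ _); rewrite subrK.
    by rewrite lerBlDr; apply: le_trans (normcD_le _ _); rewrite subrK.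
  have := normc_ge0 (f e.1 - f e.2); have := normc_ge0 (f e.1); have := normc_ge0 (f e.2).
  move: tri; move: (normc (f e.1)) (normc (f e.2)) (normc (f e.1 - f e.2)).
  move=> x y z tri y0 x0 z0.
  rewrite subr_sqr normrM [X in _ * X]ger0_norm ?addr_ge0//.
  apply: (@le_trans _ _ (z * (x + y))); first by rewrite ler_wpM2r// addr_ge0.
  rewrite -subr_ge0 (_ : _ - _ = alpha^-1 *
    ((z - alpha / 2 * (x + y)) ^+ 2 + (alpha / 2 * (x - y)) ^+ 2)); last by field.
  by rewrite mulr_ge0 ?(ltW ia0)// addr_ge0 ?sqr_ge0.
have D : (variation (fun x => normc (f x) ^+ 2)%R <=
    alpha^-1%:E * energy b f + (alpha / 2)%:E * (sqsum m f + sqsum m f))%E.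
  rewrite -(edge_mass b_ge0 b_sym b_row) /energy.
  have a20 : 0 <= alpha / 2 by rewrite divr_ge0.
  rewrite -(nsumZ (ltW ia0) u0) -(nsumZ a20 v0).
  rewrite -(nsumD (fun e => mulr_ge0 (ltW ia0) (u0 e)) (fun e => mulr_ge0 a20 (v0 e))).
  exact: le_nsum.
have HD := le_trans H D; rewrite -NK -EK in HD; move: HD.
move: (fine (sqsum m f)) (fine (energy b f)) => N E.
rewrite -(EFinD N N) -!EFinM -EFinD lee_fin => HH.
have := ler_wpM2l (ltW a0) HH; rewrite -subr_ge0 => H2; rewrite -subr_ge0.
by apply: le_trans H2 _; apply: le_of_eq; field.
Qed.

End Coarea.

End Cheeger.

(** * The heat semigroup on l^1 and its generator *)

Section RightLimits.
Context {R : realType}.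

Lemma cvg0_rightP (F : R -> \bar R) : (forall t, 0 <= F t)%E ->
  (F t @[t --> 0^'+] --> (0 : \bar R)) <->
  (forall e : R, 0 < e -> exists2 eta : R, 0 < eta &
     forall t, 0 < t -> t < eta -> (F t <= e%:E)%E).
Proof.
move=> F0; split=> [cF e e0|H].
  have : \forall t \near 0^'+, (F t < e%:E)%E.
    apply: (cF [set y | (y < e%:E)%E]); apply: open_nbhs_nbhs; split.
      exact: open_ereal_lt_ereal.
    by rewrite /= lte_fin.
  rewrite /at_right near_withinE => /nbhs_ballP[eta /= eta0 HF].
  exists eta => // t t0 te; apply/ltW/HF => //.
  by rewrite /ball /= sub0r normrN gtr0_norm.
move=> A; rewrite /= => -[e /= e0 eA].
have [eta eta0 HF] := H _ (divr_gt0 e0 (ltr0n _ 2)).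
change (\forall t \near 0^'+, A (F t)).
rewrite /at_right near_withinE; apply/nbhs_ballP; exists eta => //= t.
rewrite /ball /= sub0r normrN => te t0; rewrite gtr0_norm// in te.
have := HF t t0 te; have := F0 t; case: (F t) => [r| |]//; rewrite !lee_fin => r0 re.
apply: eA; rewrite /= /ball /= sub0r normrN ger0_norm//.
by apply: le_lt_trans re _; rewrite ltr_pdivrMr// ltr_pMr// ltr1n.
Qed.

End RightLimits.

Section Semigroups.
Context {R : realType} {X : countType} (m : X -> R) (p : R).
Hypothesis m_gt0 : forall x, 0 < m x.
Hypothesis p_ge1 : 1 <= p.
Implicit Types (f g : X -> R[i]) (T : R -> (X -> R[i]) -> X -> R[i]).

Lemma generatorP T f g :
  generator m p T f g <-> [/\ in_lp m p f, in_lp m p g & forall e : R, 0 < e ->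
    exists2 eta : R, 0 < eta & forall t, 0 < t -> t < eta ->
      (lpnorm m p (fun x => t^-1%:C * (f x - T t f x) - g x)%R <= e%:E)%E].
Proof.
pose F t := lpnorm m p (fun x => t^-1%:C * (f x - T t f x) - g x).
have F0 t : (0 <= F t)%E by exact: lpnorm_ge0.
by split=> -[fp gp H]; split=> //; exact/(cvg0_rightP F0).
Qed.

Lemma generator_eq T T' f g : (forall t, 0 <= t -> T t f = T' t f) ->
  generator m p T f g -> generator m p T' f g.
Proof.
move=> TT' /generatorP[fp gp H]; apply/generatorP; split; [exact: fp|exact: gp|].
move=> e /H[eta eta0 He]; exists eta; first exact: eta0.
by move=> t t0 te; rewrite -(TT' t (ltW t0)); exact: He.
Qed.

Lemma generator_uniq T f g g' :
  generator m p T f g -> generator m p T f g' -> g = g'.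
Proof.
move=> /generatorP[fp gp H] /generatorP[_ g'p H'].
suff d0 : (lpnorm m p (fun x => g x - g' x)%R <= 0)%E.
  apply/funext => x; apply/eqP; rewrite -subr_eq0; apply/eqP.
  exact: (congr1 (fun h => h x) (lpnorm_eq0 m_gt0 p_ge1 d0)).
apply/lee_addgt0Pr => e e0; rewrite add0e.
have e2 : 0 < e / 2 by rewrite divr_gt0.
have [a a0 Ha] := H _ e2; have [a' a'0 Ha'] := H' _ e2.
pose t := Num.min a a' / 2.
have mn : 0 < Num.min a a' by rewrite lt_min a0.
have t0 : 0 < t by rewrite divr_gt0.
have tm : t < Num.min a a' by rewrite ltr_pdivrMr// ltr_pMr// ltr1n.
move: tm; rewrite lt_min => /andP[ta ta'].
have := leeD (Ha' t t0 ta') (Ha t t0 ta); rewrite -EFinD -splitr.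
apply: le_trans; apply: le_trans (lpnormB m_gt0 p_ge1 _ _).
by rewrite le_eqVlt; apply/orP; left; apply/eqP; congr lpnorm; apply/funext => x; ring.
Qed.

Section SemigroupAlgebra.
Variable T : R -> (X -> R[i]) -> X -> R[i].
Hypothesis sgT : c0_contraction_semigroup m p T.

Lemma sg_sub t f g : 0 <= t -> in_lp m p f -> in_lp m p g ->
  T t (fun x => f x - g x) = (fun x => T t f x - T t g x).
Proof.
move=> t0 fp gp.
rewrite (_ : (fun x => f x - g x) = fun x => -1 * g x + f x); last first.
  by apply/funext => x; rewrite mulN1r addrC.
by rewrite (sg_linear sgT)//; apply/funext => x; rewrite mulN1r addrC.
Qed.

Lemma sg_scale t f (k : R[i]) : 0 <= t -> in_lp m p f ->
  T t (fun x => k * f x) = (fun x => k * T t f x).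
Proof.
move=> t0 fp; have z0 := in_lp0 m_gt0 p_ge1.
have T0 : T t (fun _ => 0) = fun _ => 0.
  have := sg_sub t0 z0 z0; rewrite (_ : (fun x => _) = fun _ => 0); last first.
    by apply/funext => x; rewrite subrr.
  by move=> {1}->; apply/funext => x; rewrite subrr.
rewrite (_ : (fun x => k * f x) = fun x => k * f x + (fun _ => 0) x); last first.
  by apply/funext => x; rewrite addr0.
by rewrite (sg_linear sgT)// T0; apply/funext => x; rewrite addr0.
Qed.

Lemma sg_continuous0 f (e : R) : in_lp m p f -> 0 < e ->
  exists2 eta : R, 0 < eta & forall t, 0 <= t -> t < eta ->
    (lpnorm m p (fun x => T t f x - f x)%R <= e%:E)%E.
Proof.
move=> fp e0; have := sg_continuous sgT fp.
move=> /cvg0_rightP-/(_ (fun t => lpnorm_ge0 m_gt0 p_ge1 _))-/(_ e e0)[eta eta0 H].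
exists eta => // t; rewrite le_eqVlt => /predU1P[<- _|]; last exact: H.
rewrite (sg_0 sgT fp) (_ : (fun x => _) = fun _ => 0); last first.
  by apply/funext => x; rewrite subrr.
by rewrite lpnorm0// lee_fin ltW.
Qed.

End SemigroupAlgebra.
End Semigroups.

Section HeatSemigroupL1.
Context {R : realType} {X : countType} (m : X -> R) (b : X -> X -> R).
Hypothesis m_gt0 : forall x, 0 < m x.
Hypothesis b_ge0 : forall x y, 0 <= b x y.
Hypothesis b_sym : forall x y, b x y = b y x.
Hypothesis b_row : forall x, nsum (b x) = (m x)%:E.
Variables (T T1 : R -> (X -> R[i]) -> X -> R[i]).
Hypothesis sgT : c0_contraction_semigroup m 2 T.
Hypothesis sgT1 : c0_contraction_semigroup m 1 T1.
Hypothesis T1E : forall (t : R) f, 0 <= t -> in_lp m 2 f -> in_lp m 1 f ->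
  T1 t f = T t f.
Hypothesis genT : forall f, in_lp m 2 f -> generator m 2 T f (lap m b f).
Implicit Types (f g : X -> R[i]).

Let p1 : 1 <= 1 :> R. Proof. exact: lexx. Qed.
Let p2 : 1 <= 2 :> R. Proof. exact: ler1n. Qed.
Local Hint Resolve p1 p2 : core.
Local Notation L := (lap m b).
Let L1 f : in_lp m 1 f -> in_lp m 1 (L f). Proof. exact: in_lp_lap. Qed.
Let L2 f : in_lp m 2 f -> in_lp m 2 (L f). Proof. exact: in_lp_lap. Qed.

(** Time discretisation of [f - T_t f - t L f = \int_0^t (T_s L f - L f) ds]
    with step [h]: the error of one step is small in l^2 since [L f] is the
    derivative there, while the Riemann sum of the integral is bounded in l^1. *)
Lemma discrete_duhamel f (h t d e : R) (k : nat) :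
  in_lp m 2 f -> in_lp m 1 f -> 0 <= h -> k%:R * h <= t ->
  (lpnorm m 2 (fun x => f x - T h f x - h%:C * L f x)%R <= (h * d)%:E)%E ->
  (forall s, 0 <= s -> s <= t -> (lpnorm m 1 (fun x => T1 s (L f) x - L f x)%R <= e%:E)%E) ->
  exists r w : X -> R[i], [/\
    forall x, f x - T (k%:R * h) f x - (k%:R * h)%:C * L f x = r x + w x,
    (lpnorm m 2 r <= (k%:R * h * d)%:E)%E &
    (lpnorm m 1 w <= (k%:R * h * e)%:E)%E].
Proof.
move=> f2 f1 h0 + fh fe; elim: k => [|k IH] kt.
  exists (fun _ => 0), (fun _ => 0); split=> [x||]; rewrite !mul0r; first last.
  - by rewrite lpnorm0.
  - by rewrite lpnorm0.
  - by rewrite (sg_0 sgT f2) !subrr addr0.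
have kh0 : 0 <= k%:R * h by rewrite mulr_ge0.
have kSh : k.+1%:R * h = k%:R * h + h by rewrite -natr1 mulrDl mul1r.
have kt' : k%:R * h <= t by apply: le_trans kt; rewrite kSh lerDl.
have [r [w [rw r2 w1]]] := IH kt'.
have Th2 : in_lp m 2 (T h f) by exact: sg_lp.
have hL2 := in_lpZ m_gt0 p2 h%:C (L2 f2).
have d2 := in_lpB m_gt0 p2 f2 Th2.
pose rho x := f x - T h f x - h%:C * L f x.
have rho2 : in_lp m 2 rho by exact: in_lpB.
have TrhoE : T (k%:R * h) rho =
    fun x => T (k%:R * h) f x - T (k.+1%:R * h) f x - h%:C * T (k%:R * h) (L f) x.
  rewrite /rho (sg_sub sgT kh0 d2 hL2) (sg_sub sgT kh0 f2 Th2).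
  rewrite (sg_scale m_gt0 p2 sgT _ kh0 (L2 f2)).
  by rewrite -(sg_add sgT kh0 h0 f2) kSh.
exists (fun x => r x + T (k%:R * h) rho x),
  (fun x => w x + h%:C * (T1 (k%:R * h) (L f) x - L f x)); split.
- move=> x; rewrite addrACA -rw TrhoE (T1E kh0 (L2 f2) (L1 f1)).
  by rewrite kSh rmorphD; ring.
- apply: le_trans (lpnormD m_gt0 p2 _ _) _; rewrite kSh mulrDl EFinD leeD//.
  by apply: le_trans fh; exact: (sg_contraction sgT kh0 rho2).
- apply: le_trans (lpnormD m_gt0 p1 _ _) _; rewrite kSh mulrDl EFinD leeD//.
  by rewrite lpnormZ// normc_real ger0_norm// EFinM lee_wpmul2l// fe.
Qed.

(** As the step tends to [0], the l^2 error tends to [0] pointwise, and the l^1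
    bound on the Riemann sums passes to the pointwise limit. *)
Lemma duhamel12 f (t e : R) : in_lp m 2 f -> in_lp m 1 f -> 0 < t ->
  (forall s, 0 <= s -> s <= t -> (lpnorm m 1 (fun x => T1 s (L f) x - L f x)%R <= e%:E)%E) ->
  (lpnorm m 1 (fun x => f x - T1 t f x - t%:C * L f x)%R <= (t * e)%:E)%E.
Proof.
move=> f2 f1 t0 fe; apply: lpnorm_le_pointwise => // s u u0.
pose c x := (m x `^ 2^-1)^-1.
have c0 x : 0 <= c x by rewrite invr_ge0 powR_ge0.
pose C := \sum_(x <- s) c x.
have C0 : 0 <= C by exact: sumr_ge0.
have C1 : 0 < C * t + 1 by rewrite ltr_wpDl// mulr_ge0// ltW.
pose d := u / (C * t + 1); have d0 : 0 < d by rewrite divr_gt0.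
have [_ _ /(_ d d0)[eta eta0 H]] := iffLR (generatorP m_gt0 p2 T f (L f)) (genT f2).
have [N [h [h0 heta Nh]]] : exists (N : nat) (h : R),
    [/\ 0 < h, h < eta & N%:R * h = t].
  exists (Num.truncn (t / eta)).+1, (t / (Num.truncn (t / eta)).+1%:R).
  split; [by rewrite divr_gt0| |by rewrite mulrCA mulfV ?mulr1// pnatr_eq0].
  by rewrite ltr_pdivrMr// -ltr_pdivrMl// mulrC truncnS_gt.
have Hh := H h h0 heta.
have fh : (lpnorm m 2 (fun x => f x - T h f x - h%:C * L f x)%R <= (h * d)%:E)%E.
  rewrite (_ : (fun x => _) = fun x => h%:C * (h^-1%:C * (f x - T h f x) - L f x)).
    by rewrite lpnormZ// normc_real gtr0_norm// EFinM lee_wpmul2l// lee_fin ltW.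
  by apply/funext => x; rewrite [in RHS]mulrBr mulVKc// gt_eqF.
have Nt : N%:R * h <= t by rewrite Nh.
have [r [w [rw r2 w1]]] := discrete_duhamel f2 f1 (ltW h0) Nt fh fe.
rewrite Nh in rw r2 w1.
exists w => // x xs; rewrite (T1E (ltW t0) f2 f1) rw addrK.
apply: le_trans (normc_le_point m_gt0 p2 x r2) _; rewrite -/(c x).
apply: (@le_trans _ _ (C * (t * d))).
  have td0 : 0 <= t * d by apply: mulr_ge0; exact: ltW.
  by rewrite ler_wpM2r// /C (big_rem x xs)/= lerDl; exact: sumr_ge0.
rewrite mulrA /d mulrCA; apply: ler_piMr; first exact: ltW.
by rewrite ler_pdivrMr// mul1r lerDl; exact: ler01.
Qed.

(** Both sides of the estimate depend continuously on [f] in l^1, where finitely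
    supported functions are dense. *)
Lemma duhamel f (t e : R) : in_lp m 1 f -> 0 < t ->
  (forall s, 0 <= s -> s <= t -> (lpnorm m 1 (fun x => T1 s (L f) x - L f x)%R <= e%:E)%E) ->
  (lpnorm m 1 (fun x => f x - T1 t f x - t%:C * L f x)%R <= (t * e)%:E)%E.
Proof.
move=> f1 t0 fe; apply/lee_addgt0Pr => u u0.
have k0 : 0 < 2 + 6 * t by rewrite addr_gt0// mulr_gt0.
pose v := u / (2 + 6 * t); have v0 : 0 < v by rewrite divr_gt0.
have [s sP] := trunc_approx m_gt0 p1 f1 v0.
pose g := trunc s f; pose d x := f x - g x; rewrite -/g -/d in sP.
have g1 : in_lp m 1 g by apply: finitely_supported_in_lp => //; exact: finitely_supported_trunc.
have g2 : in_lp m 2 g by apply: finitely_supported_in_lp => //; exact: finitely_supported_trunc.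
have d1 : in_lp m 1 d by exact: in_lpB.
have LdE : L d = fun x => L f x - L g x by exact: (lapB m_gt0 b_ge0 b_sym b_row p1).
have Ld : (lpnorm m 1 (L d) <= (v + v)%:E)%E.
  by apply: le_trans (lpnorm_lap m_gt0 b_ge0 b_sym b_row p1 d1) _; rewrite EFinD leeD.
have ge r : 0 <= r -> r <= t ->
    (lpnorm m 1 (fun x => T1 r (L g) x - L g x)%R <= (e + (4 * v))%:E)%E.
  move=> r0 rt.
  rewrite (_ : (fun x => _) = fun x => (T1 r (L f) x - L f x) - (T1 r (L d) x - L d x)).
    have -> : e + 4 * v = e + ((v + v) + (v + v)) by ring.
    rewrite EFinD; apply: le_trans (lpnormB m_gt0 p1 _ _) (leeD (fe r r0 rt) _).
    rewrite EFinD; apply: le_trans (lpnormB m_gt0 p1 _ _) (leeD _ Ld).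
    by apply: le_trans Ld; exact: (sg_contraction sgT1 r0 (L1 d1)).
  rewrite LdE (sg_sub sgT1 r0 (L1 f1) (L1 g1)).
  by apply/funext => x; ring.
have Dg := duhamel12 g2 g1 t0 ge.
rewrite (_ : (fun x => _) = fun x => (g x - T1 t g x - t%:C * L g x)
    + ((d x - T1 t d x) - t%:C * L d x)); last first.
  rewrite LdE (_ : T1 t d = fun x => T1 t f x - T1 t g x); last first.
    exact: (sg_sub sgT1 (ltW t0) f1 g1).
  by apply/funext => x; rewrite /d; ring.
rewrite -EFinD; have -> : t * e + u = t * (e + 4 * v) + ((v + v) + t * (v + v)).
  have -> : u = v * (2 + 6 * t) by rewrite /v mulfVK// gt_eqF.
  by ring.
rewrite EFinD; apply: le_trans (lpnormD m_gt0 p1 _ _) (leeD Dg _).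
rewrite EFinD; apply: le_trans (lpnormB m_gt0 p1 _ _) (leeD _ _).
  rewrite EFinD; apply: le_trans (lpnormB m_gt0 p1 _ _) (leeD sP _).
  by apply: le_trans sP; exact: (sg_contraction sgT1 (ltW t0) d1).
by rewrite lpnormZ// normc_real gtr0_norm// EFinM lee_wpmul2l// lee_fin ltW.
Qed.

Lemma generator_L1 f : in_lp m 1 f -> generator m 1 T1 f (L f).
Proof.
move=> f1; apply/(generatorP m_gt0 p1); split; [exact: f1|exact: L1|move=> e e0].
have [eta eta0 H] := sg_continuous0 m_gt0 p1 sgT1 (L1 f1) e0.
exists eta => // t t0 te.
have D := duhamel f1 t0 (fun s s0 st => H s s0 (le_lt_trans st te)).
rewrite (_ : (fun x => _) = fun x => t^-1%:C * (f x - T1 t f x - t%:C * L f x)).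
  rewrite lpnormZ// normc_real ger0_norm ?invr_ge0 ?(ltW t0)//.
  by rewrite lee_pdivrMl// -EFinM.
by apply/funext => x; rewrite [in RHS]mulrBr mulKVc// gt_eqF.
Qed.

Lemma generator_L1P f g : generator m 1 T1 f g <-> in_lp m 1 f /\ g = L f.
Proof.
split=> [G|[f1 ->]]; last exact: generator_L1.
have f1 : in_lp m 1 f by case: G.
by split=> //; exact: (generator_uniq m_gt0 p1 G (generator_L1 f1)).
Qed.

End HeatSemigroupL1.

(** * The bottom of the spectrum *)

Section InfSpectrum.
Context {R : realType} {X : countType} (m : X -> R) (p : R) (A : operator R X).

Lemma inf_spectrum_ge (kappa : R) :
  (forall lambda, complex.Re lambda < kappa -> resolvent_set m p A lambda) ->
  (kappa%:E <= inf_spectrum m p A)%E.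
Proof.
move=> H; apply: le_ereal_inf_tmp => _ [lambda sl <-].
by rewrite lee_fin leNgt; apply/negP => /H.
Qed.

Lemma inf_spectrum_eq0 :
  (forall lambda, complex.Re lambda < 0 -> resolvent_set m p A lambda) ->
  spectrum m p A 0 -> inf_spectrum m p A = 0%E.
Proof.
move=> H s0; apply/eqP; rewrite eq_le inf_spectrum_ge// andbT.
by apply: ereal_inf_lbound; exists 0.
Qed.

End InfSpectrum.

Section BottomOfSpectrum.
Context {R : realType} {X : countType} (m : X -> R) (b : X -> X -> R).
Hypothesis m_gt0 : forall x, 0 < m x.
Hypothesis b_ge0 : forall x y, 0 <= b x y.
Hypothesis b_sym : forall x y, b x y = b y x.
Hypothesis b_row : forall x, nsum (b x) = (m x)%:E.
Implicit Types (f g : X -> R[i]).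

Let p1 : 1 <= 1 :> R. Proof. exact: lexx. Qed.
Let p2 : 1 <= 2 :> R. Proof. exact: ler1n. Qed.
Local Hint Resolve p1 p2 : core.

Definition cindic (s : seq X) x : R[i] := (indic s x)%:C.

Lemma in_lp_cindic p s : 1 <= p -> in_lp m p (cindic s).
Proof.
move=> p_ge1; apply: finitely_supported_in_lp => //.
apply: (@sub_finite_set _ _ [set` s]) => // x /=; rewrite /cindic /indic.
by case: (x \in s); rewrite ?eqxx.
Qed.

(** The Laplacian maps l^1 into the functions with zero [m]-mass, hence its range
    misses the indicator of a point. *)
Lemma spectrum1_0 (A : operator R X) (x0 : X) :
  (forall f g, A f g <-> in_lp m 1 f /\ g = lap m b f) -> spectrum m 1 A 0.
Proof.
move=> AE [onto _].
have i1 := in_lp_cindic [:: x0] p1.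
have [f [/AE[f1 fE] _]] := onto _ i1.
have msum g : in_lp m 1 g -> csummable (fun x => (m x)%:C * g x).
  move=> g1; apply: nsum_lty_le (in_lp_sum (lexx 1) g1) => x.
  by rewrite normcM normc_real gtr0_norm// powRr1// mulrC.
have w1 := in_lp_walk m_gt0 b_ge0 b_sym b_row p1 f1.
have : csum (fun x => (m x)%:C * cindic [:: x0] x) = 0.
  rewrite -(subrr (csum (fun x => (m x)%:C * f x))).
  rewrite -{2}(mass_walk m_gt0 b_ge0 b_sym b_row f1) -csumB; [|exact: msum..].
  apply: eq_csum => x; rewrite -mulrBr; congr (_ * _).
  by have := congr1 (fun h => h x) fE; rewrite mul0r add0r.
have mi0 x : 0 <= m x * indic [:: x0] x by rewrite mulr_ge0 ?indic_ge0// ltW.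
rewrite (eq_csum (v := fun x => (m x * indic [:: x0] x)%:C)); last first.
  by move=> x; rewrite rmorphM.
rewrite csum_real rsum_pos// => -[H].
have oo : (nsum (fun x => m x * indic [:: x0] x)%R < +oo)%E.
  apply: nsum_lty_le (msum _ i1) => x; rewrite normcM !normc_real.
  by rewrite !ger0_norm ?indic_ge0// ltW.
have := nsum_ge1 (fun x => m x * indic [:: x0] x) x0.
rewrite -(fine_nsumK mi0 oo) H lee_fin /indic mem_head mulr1 leNgt.
by rewrite m_gt0.
Qed.

Lemma normc_cindic s x : normc (cindic s x) ^+ 2 = indic s x.
Proof.
rewrite /cindic normc_real ger0_norm ?indic_ge0// /indic.
by case: (x \in s); rewrite ?expr1n ?expr0n.
Qed.

(** For the indicator of a finite set [W], the squared norm is [n(W)] and the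
    squared norm of the Laplacian is at most twice the boundary size of [W]. *)
Lemma cheeger_of_bounded_below (K : R) : 0 <= K ->
  (forall f, in_lp m 2 f -> (lpnorm m 2 f <= K%:E * lpnorm m 2 (lap m b f))%E) ->
  exists2 beta, 0 < beta & cheeger_set b beta.
Proof.
move=> K0 bel; have k0 : 0 < 2 * K ^+ 2 + 1 by rewrite ltr_wpDl// mulr_ge0// exprn_ge0.
exists (2 * K ^+ 2 + 1)^-1; first by rewrite invr_gt0.
split=> [|W /finite_seqP[s ->]]; first by rewrite invr_ge0 ltW.
have i2 := in_lp_cindic s p2.
have /(lpnorm2_le m_gt0 _ _ K0) H := bel _ i2.
have K20 : (0 <= (K ^+ 2)%:E)%E by rewrite lee_fin exprn_ge0.
have {}H := le_trans H (lee_wpmul2l K20 (sqsum_lap_le m_gt0 b_ge0 b_sym b_row i2)).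
have massE : sqsum m (cindic s) = deg_set b [set` s].
  rewrite (deg_setE b_row); apply: eq_nsum => x.
  by rewrite normc_cindic.
have varE : energy b (cindic s) = (boundary_size b [set` s] + boundary_size b [set` s])%E.
  rewrite -(variation_indic b_ge0 b_sym); apply: eq_nsum => e; congr (_ * _).
  rewrite /cindic -rmorphB normc_real /indic.
  by case: (e.1 \in s) (e.2 \in s) => [] [];
    rewrite ?(subrr, subr0, sub0r, normrN, normr0, normr1, expr1n, expr0n).
have B0 : (0 <= boundary_size b [set` s])%E.
  by apply: esum_ge0 => e _; rewrite lee_fin.
have Boo : (boundary_size b [set` s] < +oo)%E.
  apply: le_lt_trans (energy_lty m_gt0 b_ge0 b_sym b_row i2).
  by rewrite varE leeDl.
rewrite -massE; move: H; rewrite varE -(sqsumK m_gt0 i2).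
move: (fine _) B0 Boo => N; case: (boundary_size _ _) => [r| |]// r0 _.
rewrite -EFinD -!EFinM !lee_fin in r0 * => H.
rewrite ler_pdivrMl//; apply: le_trans H _.
by rewrite -subr_ge0; apply: le_trans r0 _; apply: le_of_eq; ring.
Qed.

End BottomOfSpectrum.

Lemma is_graph_facts (R : realType) (X : countType) (m : X -> R)
    (b : X -> X -> R) (c : X -> R) :
  is_graph b c -> (forall x, m x = deg b x) ->
  [/\ forall x y, 0 <= b x y, forall x y, b x y = b y x &
      forall x, nsum (b x) = (m x)%:E].
Proof.
move=> [b0 bs _ boo _ _] mE; split=> // x.
by rewrite mE /deg fine_nsumK.
Qed.

Theorem proposition6p3 (R : realType) (X : countType)
    (m : X -> R) (b : X -> X -> R) (c : X -> R) (alpha : R)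
    (L1 L2 : operator R X)
    (m_gt0 : forall x, 0 < m x)
    (graph_bc : is_graph b c)
    (m_eq_n : forall x, m x = deg b x)
    (c_eq0 : forall x, c x = 0)
    (alphaP : is_cheeger_constant b alpha)
    (L1P : is_lp_laplacian m b c 1 L1)
    (L2P : is_lp_laplacian m b c 2 L2) :
  inf_spectrum m 1 L1 = inf_spectrum m 2 L2 <-> alpha = 0.
Proof.
have [b_ge0 b_sym b_row] := is_graph_facts graph_bc m_eq_n.
have p1 : 1 <= 1 :> R by exact: lexx.
have p2 : 1 <= 2 :> R by exact: ler1n.
have lapP := form_laplacianP m_gt0 b_ge0 b_sym b_row c_eq0.
have L1E f g : L1 f g <-> in_lp m 1 f /\ g = lap m b f.
  have [T [T1 [[sgT genT] sgT1 T1E L1G]]] := L1P.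
  have gen f' : in_lp m 2 f' -> generator m 2 T f' (lap m b f').
    by move=> f2; apply/genT/lapP.
  apply: iff_trans (L1G f g) _.
  exact: (generator_L1P m_gt0 b_ge0 b_sym b_row sgT sgT1 T1E gen).
have L2E f g : L2 f g <-> in_lp m 2 f /\ g = lap m b f.
  have [T [T2 [[sgT genT] sgT2 T2E L2G]]] := L2P.
  apply: iff_trans (L2G f g) _; apply: iff_trans (lapP f g).
  apply: iff_trans (genT f g).
  have T2E' f' t : in_lp m 2 f' -> 0 <= t -> T2 t f' = T t f'.
    by move=> f2 t0; exact: T2E.
  split=> G; have f2 : in_lp m 2 f by case: G.
    by apply: (generator_eq m_gt0 p2 _ G) => t t0; exact: T2E'.
  by apply: (generator_eq m_gt0 p2 _ G) => t t0; rewrite T2E'.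
have x0 : exists x : X, true.
  apply: contrapT => nX; have := alphaP.2 (alpha + 1); case: alphaP => -[a0 _] _.
  have : cheeger_set b (alpha + 1).
    split=> [|W _]; first by rewrite addr_ge0.
    rewrite /deg_set esum1 ?mule0; last by move=> x _; case: nX; exists x.
    by apply: esum_ge0 => e _; rewrite lee_fin.
  by move=> /[swap] /[apply]; rewrite gerDl ler10.
have [x _] := x0.
have res1 := resolvent_Re_lt0 m_gt0 b_ge0 b_sym b_row p1 L1E.
have res2 := resolvent_Re_lt0 m_gt0 b_ge0 b_sym b_row p2 L2E.
have -> : inf_spectrum m 1 L1 = 0%E.
  apply: inf_spectrum_eq0 => //.
  exact: (spectrum1_0 m_gt0 b_ge0 b_sym b_row x L1E).
have [[alpha_ge0 isop] alpha_max] := alphaP.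
split=> [inf2|alpha0].
  apply: contrapT => an0; have a0 : 0 < alpha.
    by rewrite lt_neqAle alpha_ge0 andbT eq_sym; apply/eqP.
  have := @inf_spectrum_ge _ _ m 2 L2 (alpha ^+ 2 / 2).
  rewrite -inf2 lee_fin => H.
  have : 0 < alpha ^+ 2 / 2 by rewrite divr_gt0// exprn_gt0.
  rewrite ltNge H// => lambda.
  apply: (resolvent_below_gap m_gt0 b_ge0 b_sym b_row c_eq0 _ L2E) => f f2.
  rewrite (mulrC 2) mulfVK//.
  exact: (cheeger_inequality m_gt0 b_ge0 b_sym b_row alpha_ge0 isop f2).
apply/esym/inf_spectrum_eq0 => // -[_ [K KP]].
have [|f f2|beta beta0 betaP] := cheeger_of_bounded_below m_gt0 b_ge0 b_sym b_row (K := `|K|).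
- exact: normr_ge0.
- have /KP H : L2 f (lap m b f) by apply/L2E.
  rewrite (_ : (fun x => _) = lap m b f) in H.
    apply: le_trans H _; rewrite lee_wpmul2r ?lpnorm_ge0// lee_fin.
    exact: ler_norm.
  by apply/funext => y; rewrite mul0r subr0.
- by have := alpha_max _ betaP; rewrite alpha0 leNgt beta0.
Qed.
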